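(* Let $K$ be a field, $Q$ a finite quiver, $\succ$ a length admissible order on the set $\mathcal B$ of paths of $Q$, and $\mathcal T$ a set of paths of length $2$ in $Q$. Let $\mathbf 0=(0,\dots,0)\in\mathcal A$. The following statements hold: (1) $\mathcal G(\mathbf 0)=\mathcal T$. (2) The element $\mathbf 0\in\mathcal A$ is in $\mathrm{GrAlg}(\mathcal T)$ and corresponds to the strong Koszul algebra $KQ/\langle\mathcal T\rangle$ (with respect to $\langle\mathcal T\rangle$ and $\succ$). (3) Let $\Lambda=KQ/I$ be a length graded algebra (i.e. $I$ is a graded ideal). Then $\Lambda$ is a strong Koszul algebra (with respect to $I$ and $\succ$) corresponding to a point in $\mathrm{GrAlg}(\mathcal T)$ if and only if $I_{Mon}=\langle\mathcal T\rangle$. (4) If $I$ is an ideal in $KQ$ generated by length homogeneous elements, then $KQ/I$ corresponds to an element in the zero set of $\mathcal I$ if and only if $(KQ/I)_{Mon}=KQ/I_{Mon}=KQ/\langle\mathcal T\rangle$. (5) There is exactly one algebra with quadratic monomial Gröbner basis (a Gröbner basis consisting of paths of length $2$) that corresponds to a point in $\mathrm{GrAlg}(\mathcal T)$, namely $KQ/\langle\mathcal T\rangle$.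
   Context: $KQ$ is the path algebra, $\mathcal B$ the set of all finite directed paths in $Q$ (vertices are paths of length $0$), $\ell(p)$ the length of a path; paths are written left to right, so a path $p$ from $v$ to $w$ satisfies $vpw=p$. ''Ideal'' means two-sided ideal and $\langle X\rangle$ is the two-sided ideal generated by $X$. A length admissible order is a well-order $\succ$ on $\mathcal B$ such that for $p,q,r,s,t\in\mathcal B$: $p\succ q$ implies $pr\succ qr$ if both are nonzero; $p\succ q$ implies $sp\succ sq$ if both are nonzero; $p=rqt$ implies $p\succeq q$; and $\ell(p)>\ell(q)$ implies $p\succ q$. For nonzero $x=\sum_{p\in\mathcal B}\alpha_p p\in KQ$, $\mathrm{tip}(x)$ is the $\succ$-largest $p$ with $\alpha_p\neq 0$; for $X\subseteq KQ$, $\mathrm{tip}(X)=\{\mathrm{tip}(x): x\in X, x\ne 0\}$. A nonzero $x$ is uniform if $x=vxw$ for some vertices $v,w$; an element is quadratic if it is a $K$-linear combination of paths of length $2$. An ideal is graded if it is generated by length homogeneous elements. A Gröbner basis of a graded ideal $I$ is a set $\mathcal G\subseteq I$ of length homogeneous uniform elements with $\langle\mathrm{tip}(\mathcal G)\rangle=\langle \mathrm{tip}(I)\rangle$. $KQ/I$ is a strong Koszul algebra (with respect to $I$ and $\succ$) if $I$ has a Gröbner basis with respect to $\succ$ consisting of quadratic elements. $I_{Mon}=\langle\mathrm{tip}(I)\rangle$ and $(KQ/I)_{Mon}=KQ/I_{Mon}$; quotients of $KQ$ are regarded as equal exactly when the ideals are equal. Given $\mathcal T$: $\mathcal N=\mathcal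 B\setminus \mathrm{tip}(\langle\mathcal T\rangle)$ (the paths having no subpath in $\mathcal T$); $\mathcal N_i$ is the set of paths of length $i$ in $\mathcal N$; for $t\in\mathcal T$, $\mathcal N_2(t)$ is the set of $n\in\mathcal N_2$ with $t\succ n$ and $n$ having the same start vertex and the same end vertex as $t$. Put $D=\sum_{t\in\mathcal T}|\mathcal N_2(t)|$ and $\mathcal A=K^D$, with points written $X=(x_{t,n})_{t\in\mathcal T,\,n\in\mathcal N_2(t)}$. For $X\in\mathcal A$, $\mathcal G(X)=\{g_t : t\in\mathcal T\}$ with $g_t=t-\sum_{n\in\mathcal N_2(t)}x_{t,n}n$. $\mathrm{GrAlg}(\mathcal T)=\{X\in\mathcal A : KQ/\langle \mathcal G(X)\rangle$ is a strong Koszul algebra with respect to $\langle\mathcal G(X)\rangle$ and $\succ\}$. The algebra $KQ/I$ corresponds to the point $X\in\mathcal A$ if $I=\langle\mathcal G(X)\rangle$. The set of polynomials $\mathcal I$: let $\mathbf y=\{y_{t,n}: t\in\mathcal T,n\in\mathcal N_2(t)\}$ be commuting variables and $R=KQ[\mathbf y]$, whose elements are finite sums $\sum_{p\in\mathcal B}f_p(\mathbf y)p$ with $f_p\in K[\mathbf y]$, the variables commuting with $KQ$. Let $h_t=t-\sum_{n\in\mathcal N_2(t)}y_{t,n}n$ and $\mathcal H=\{h_t:t\in\mathcal T\}$. A simple reduction of $F=\sum f_p(\mathbf y)p$ by $\mathcal H$ replaces a term $f_p(\mathbf y)p$ with $f_p\neq0$ and $p=qtr$ ($t\in\mathcal T$,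 $q,r$ paths) by $f_p(\mathbf y)\sum_{n\in\mathcal N_2(t)}y_{t,n}\,qnr$. A complete reduction of $F$ is an element obtained from $F$ by finitely many simple reductions and admitting no further simple reduction. For each pair $t=ab$, $t'=bc$ in $\mathcal T$ with $a,b,c$ arrows ($t=t'=a^2$ allowed), put $Ov(t,t')=h_t c-a h_{t'}$, and choose a complete reduction $\sum_{\hat n\in\mathcal N_3}f^*_{t,t',\hat n}(\mathbf y)\hat n$ of $Ov(t,t')$ by $\mathcal H$. Then $\mathcal I$ is the set of all polynomials $f^*_{t,t',\hat n}(\mathbf y)$, for all such pairs $t,t'$ and all $\hat n\in\mathcal N_3$; its zero set is taken in $\mathcal A$. *)

(* Defs.v *)
From HB Require Import structures.
From Stdlib Require Import Relation_Operators.
From mathcomp Require Import all_boot all_order all_algebra finmap.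
From mathcomp Require Import boolp classical_sets.
From mathcomp Require Import mpoly monalg.

Set Implicit Arguments.
Unset Strict Implicit.
Unset Printing Implicit Defensive.

Import GRing.Theory.

Local Open Scope fset_scope.
Local Open Scope classical_set_scope.
Local Open Scope ring_scope.

(* Both mpoly and monalg use this notation; it is the monalg one here. *)
Notation "g @_ k" := (monalg.mcoeff k g) : ring_scope.

Record quiver := Quiver {
  vertex : finType;
  arrow : finType;
  src : arrow -> vertex;
  tgt : arrow -> vertex
}.

Section Walks.
Variable Q : quiver.
Implicit Types (v : vertex Q) (s : seq (arrow Q)).

Fixpoint is_walk v s : bool :=
  if s is a :: s' then (src a == v) && is_walk (tgt a) s' else true.

Definition walk_end v s : vertex Q := last v [seq tgt a | a <- s].

Lemma is_walk_cat v s1 s2 :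
  is_walk v (s1 ++ s2) = is_walk v s1 && is_walk (walk_end v s1) s2.
Proof. by elim: s1 v => [|a s1 IH] v //=; rewrite IH andbA. Qed.

Lemma walk_end_cat v s1 s2 :
  walk_end v (s1 ++ s2) = walk_end (walk_end v s1) s2.
Proof. by rewrite /walk_end map_cat last_cat. Qed.
End Walks.

(* A path is a start vertex together with a walk from it; the start vertex
   is what distinguishes the paths of length 0. *)
Record qpath (Q : quiver) := QPath {
  path_val : vertex Q * seq (arrow Q);
  _ : is_walk path_val.1 path_val.2
}.
HB.instance Definition _ (Q : quiver) := [isSub for @path_val Q].
HB.instance Definition _ (Q : quiver) := [Choice of qpath Q by <:].

Section Paths.
Variable Q : quiver.
Implicit Types (p q r : qpath Q).

Definition pstart p : vertex Q := (val p).1.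
Definition parrows p : seq (arrow Q) := (val p).2.
Definition pend p : vertex Q := walk_end (pstart p) (parrows p).
Definition plen p : nat := size (parrows p).

Definition pvert (v : vertex Q) : qpath Q := @QPath Q (v, [::]) isT.

Lemma parr_subproof (a : arrow Q) : is_walk (src a) [:: a].
Proof. by rewrite /= eqxx. Qed.
Definition parr (a : arrow Q) : qpath Q :=
  @QPath Q (src a, [:: a]) (parr_subproof a).

(* [None] stands for the zero of the path algebra. *)
Definition pmul p q : option (qpath Q) :=
  if pend p == pstart q then insub (pstart p, parrows p ++ parrows q)
  else None.

(* [rqt] as an element of [option]: zero as soon as one product is zero. *)
Definition pmul3 r q t : option (qpath Q) := obind (pmul r) (pmul q t).

Definition paths_of_len (d : nat) : seq (qpath Q) :=
  pmap insub
    [seq (v, tval s) | v <- enum (vertex Q), s <- enum {: d.-tuple (arrow Q)}].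

Lemma mem_paths_of_len d p : (p \in paths_of_len d) = (plen p == d).
Proof.
rewrite /paths_of_len mem_pmap_sub /plen /parrows.
case: p => -[v s] /= w; apply/allpairsP/eqP => /= [[[u t]]|sd].
  by move=> /= [_ _ [_ ->]]; rewrite size_tuple.
have h : size s == d by apply/eqP.
by exists (v, Tuple h) => /=; rewrite !mem_enum.
Qed.

Lemma pmulP p q r :
  reflect [/\ pend p = pstart q, pstart r = pstart p
            & parrows r = parrows p ++ parrows q]
          (pmul p q == Some r).
Proof.
rewrite /pmul; have [e|ne] := eqVneq (pend p) (pstart q); last first.
  by apply: (iffP idP) => [/eqP|[/eqP]] //; rewrite (negPf ne).
case: insubP => [u _ uE|]; last first.
  rewrite /= is_walk_cat (valP p) /= -/(parrows p) -/(pstart p) -/(pend p) e.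
  by rewrite (valP q).
apply: (iffP idP) => [/eqP[<-]|[_ r1 r2]]; first by rewrite /pstart /parrows uE.
apply/eqP; congr Some; apply: val_inj; rewrite [LHS]uE -r1 -r2.
by rewrite /pstart /parrows; case: (val r).
Qed.

Lemma pmul_ex p q : pend p = pstart q -> exists r, pmul p q = Some r.
Proof.
move=> e; rewrite /pmul e eqxx; case: insubP => [u _ _|]; first by exists u.
rewrite /= is_walk_cat (valP p) /= -/(parrows p) -/(pstart p) -/(pend p) e.
by rewrite (valP q).
Qed.

Lemma pmul_none p q : pmul p q = None -> pend p <> pstart q.
Proof. by move=> h /pmul_ex[r]; rewrite h. Qed.

Lemma pmulA p q r : obind (pmul p) (pmul q r) = obind (pmul^~ r) (pmul p q).
Proof.
case qr: (pmul q r) => [u|]; case pq: (pmul p q) => [w|] //=.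
- move/eqP/pmulP: qr => [e1 u1 u2]; move/eqP/pmulP: pq => [e2 w1 w2].
  have [z pu] : exists z, pmul p u = Some z by apply: pmul_ex; rewrite u1.
  rewrite pu; apply/esym/eqP/pmulP; move/eqP/pmulP: pu => [e3 z1 z2].
  split; last 2 first.
  - by rewrite z1.
  - by rewrite z2 u2 w2 catA.
  by rewrite /pend w1 w2 walk_end_cat -/(pend p) e2.
- move/pmul_none: pq => pq; move/eqP/pmulP: qr => [_ u1 _].
  by case pu: (pmul p u) => [z|] //; move/eqP/pmulP: pu => [e _ _]; case: pq; rewrite e.
- move/pmul_none: qr => qr; move/eqP/pmulP: pq => [e w1 w2].
  case wr: (pmul w r) => [z|] //; move/eqP/pmulP: wr => [e' _ _]; case: qr.
  by rewrite -e' [RHS]/pend w1 w2 walk_end_cat -/(pend p) e.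
Qed.
End Paths.

(* Finite formal A-linear combinations of paths.  A fresh name is needed
   since the product differs from the one {malg} has over a monoid. *)
Definition pathalg (A : comNzRingType) (Q : quiver) : Type := {malg A[qpath Q]}.
HB.instance Definition _ A Q := GRing.Lmodule.on (pathalg A Q).

Lemma biadditive_assoc (A : comNzRingType) (P : choiceType)
    (m : {malg A[P]} -> {malg A[P]} -> {malg A[P]}) :
  left_distributive m +%R -> right_distributive m +%R ->
  (forall a b c p q r, m << a *g p >> (m << b *g q >> << c *g r >>) =
                       m (m << a *g p >> << b *g q >>) << c *g r >>) ->
  associative m.
Proof.
move=> mDl mDr mU.
have m0l x : m 0 x = 0 by apply: (addrI (m 0 x)); rewrite -mDl !addr0.
have m0r x : m x 0 = 0 by apply: (addrI (m x 0)); rewrite -mDr !addr0.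
have msl I (s : seq I) F y : m (\sum_(i <- s) F i) y = \sum_(i <- s) m (F i) y.
  exact: (big_morph (m^~ y) (fun u w => mDl u w y) (m0l y)).
have msr I (s : seq I) F y : m y (\sum_(i <- s) F i) = \sum_(i <- s) m y (F i).
  exact: (big_morph (m y) (mDr y) (m0r y)).
have decomp (x : {malg A[P]}) : exists (d : seq P) F, x = \sum_(p <- d) << F p *g p >>.
  by exists (msupp x : seq _), (fun p => x@_p); exact: monalgE.
move=> x y z; have [d [F ->]] := decomp x.
have [d' [F' ->]] := decomp y; have [d'' [F'' ->]] := decomp z.
rewrite !msl; apply/eq_bigr=> p _.
rewrite (msr _ d') [in RHS](msr _ d') msl; apply/eq_bigr=> q _.
by rewrite (msr _ d'') (msr _ d'') [RHS](msr _ d''); apply/eq_bigr=> r _.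
Qed.

Section PathAlgebra.
Variables (A : comNzRingType) (Q : quiver).
Implicit Types (x y z : pathalg A Q) (p q r : qpath Q) (a b c : A).

Definition pterm c (o : option (qpath Q)) : pathalg A Q :=
  if o is Some p then << c *g p >> else 0.

Definition pone : pathalg A Q := \sum_(v : vertex Q) << pvert v >>.

Definition pamul x y : pathalg A Q :=
  \sum_(p <- msupp x) \sum_(q <- msupp y) pterm (x@_p * y@_q) (pmul p q).

Let pterm0 o : pterm 0 o = 0.
Proof. by case: o => //= p; rewrite monalgU0. Qed.

Let ptermD a b o : pterm (a + b) o = pterm a o + pterm b o.
Proof. by case: o => /= [p|]; rewrite ?addr0 // monalgUD. Qed.

Let pamulw (d1 d2 : {fset qpath Q}) x y :
  (msupp x `<=` d1)%fset -> (msupp y `<=` d2)%fset ->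
  pamul x y = \sum_(p <- d1) \sum_(q <- d2) pterm (x@_p * y@_q) (pmul p q).
Proof.
move=> le1 le2; rewrite /pamul (big_fset_incl _ le1) /=.
  apply/eq_bigr=> p _; apply/big_fset_incl => // q _ /mcoeff_outdom ->.
  by rewrite mulr0 pterm0.
move=> p _ /mcoeff_outdom xp.
by rewrite big1 => // q _; rewrite xp mul0r pterm0.
Qed.

Let pamulDl : left_distributive pamul +%R.
Proof.
move=> x y z.
rewrite (pamulw (msuppD_le x y) (fsubset_refl _)).
rewrite (pamulw (fsubsetUl _ (msupp y)) (fsubset_refl (msupp z))).
rewrite (pamulw (fsubsetUr (msupp x) _) (fsubset_refl (msupp z))).
rewrite -big_split /=; apply/eq_bigr=> p _.
rewrite -big_split /=; apply/eq_bigr=> q _.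
by rewrite mcoeffD mulrDl ptermD.
Qed.

Let pamulDr : right_distributive pamul +%R.
Proof.
move=> z x y.
rewrite (pamulw (fsubset_refl _) (msuppD_le x y)).
rewrite (pamulw (fsubset_refl (msupp z)) (fsubsetUl _ (msupp y))).
rewrite (pamulw (fsubset_refl (msupp z)) (fsubsetUr (msupp x) _)).
rewrite -big_split /=; apply/eq_bigr=> p _.
rewrite -big_split /=; apply/eq_bigr=> q _.
by rewrite mcoeffD mulrDr ptermD.
Qed.

Let pamul0l x : pamul 0 x = 0.
Proof. by rewrite /pamul msupp0 big_seq_fset0. Qed.

Let pamul0r x : pamul x 0 = 0.
Proof. by rewrite /pamul big1 // => p _; rewrite msupp0 big_seq_fset0. Qed.

Lemma pamulUU a b p q :
  pamul << a *g p >> << b *g q >> = pterm (a * b) (pmul p q).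
Proof. by rewrite (pamulw msuppU_le msuppU_le) !big_seq_fset1 !mcoeffUU. Qed.

Let pamul_suml I (s : seq I) F y :
  pamul (\sum_(i <- s) F i) y = \sum_(i <- s) pamul (F i) y.
Proof. exact: (big_morph (pamul^~ y) (fun u w => pamulDl u w y) (pamul0l y)). Qed.

Let pamul_sumr I (s : seq I) F y :
  pamul y (\sum_(i <- s) F i) = \sum_(i <- s) pamul y (F i).
Proof. exact: (big_morph (pamul y) (pamulDr y) (pamul0r y)). Qed.

Let pamulA : associative pamul.
Proof.
apply: (biadditive_assoc pamulDl pamulDr) => a b c p q r; rewrite !pamulUU.
have := pmulA p q r.
case: (pmul q r) => [u|]; case: (pmul p q) => [w|] /= e.
- by rewrite !pamulUU e mulrA.
- by rewrite pamulUU e pamul0l.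
- by rewrite pamulUU -e pamul0r.
- by rewrite pamul0l pamul0r.
Qed.

Let pamul1l : left_id pone pamul.
Proof.
move=> x; rewrite [in LHS](monalgE x) [in RHS](monalgE x).
rewrite pamul_sumr; apply/eq_bigr=> p _.
rewrite /pone pamul_suml (bigD1 (pstart p)) //= big1 => [|v /negPf ne].
  rewrite addr0 pamulUU mul1r.
  by have -> : pmul (pvert (pstart p)) p = Some p by apply/eqP/pmulP.
rewrite pamulUU; case e: (pmul _ _) => [u|] //.
by move/eqP/pmulP: e => [/eqP]; rewrite /pend /= ne.
Qed.

Let pamul1r : right_id pone pamul.
Proof.
move=> x; rewrite [in LHS](monalgE x) [in RHS](monalgE x).
rewrite pamul_suml; apply/eq_bigr=> p _.
rewrite /pone pamul_sumr (bigD1 (pend p)) //= big1 => [|v /negPf ne].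
  rewrite addr0 pamulUU mulr1.
  have -> // : pmul p (pvert (pend p)) = Some p.
  by apply/eqP/pmulP; rewrite cats0.
rewrite pamulUU; case e: (pmul _ _) => [u|] //.
by move/eqP/pmulP: e => [/eqP]; rewrite eq_sym ne.
Qed.

(* Only a possibly-zero ring: the quiver may have no vertex. *)
HB.instance Definition _ := GRing.Zmodule_isPzRing.Build (pathalg A Q)
  pamulA pamul1l pamul1r pamulDl pamulDr.

Lemma pathalg_mulE x y : x * y = pamul x y. Proof. by []. Qed.

Definition pth p : pathalg A Q := << p >>.

Lemma pth_mul p q : pth p * pth q = oapp pth 0 (pmul p q).
Proof. by rewrite pathalg_mulE pamulUU mulr1; case: (pmul p q). Qed.

End PathAlgebra.

Definition two_sided_ideal (R : pzRingType) (I : set R) : Prop :=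
  [/\ I 0, forall x y, I x -> I y -> I (x + y),
      forall a x, I x -> I (a * x) & forall a x, I x -> I (x * a)].

Definition ideal_gen (R : pzRingType) (X : set R) : set R :=
  [set x | forall J, two_sided_ideal J -> X `<=` J -> J x].

Record length_admissible (Q : quiver) (gt : rel (qpath Q)) : Prop := {
  la_irr : irreflexive gt;
  la_trans : transitive gt;
  la_total : forall p q, p != q -> gt p q || gt q p;
  la_least : forall S : set (qpath Q), S !=set0 ->
    exists2 m, S m & forall p, S p -> p != m -> gt p m;
  la_mulr : forall p q r pr qr, pmul p r = Some pr -> pmul q r = Some qr ->
    gt p q -> gt pr qr;
  la_mull : forall p q s sp sq, pmul s p = Some sp -> pmul s q = Some sq ->
    gt p q -> gt sp sq;
  la_sub : forall p q r t, pmul3 r q t = Some p -> (p == q) || gt p q;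
  la_len : forall p q, (plen q < plen p)%N -> gt p q
}.

(* The algebra KQ/I is represented by the ideal I. *)

Section Groebner.
Variables (K : fieldType) (Q : quiver) (gt : rel (qpath Q)).
Local Notation KQ := (pathalg K Q).
Implicit Types (x : KQ) (X I G : set KQ) (p q : qpath Q) (P : set (qpath Q)).

Definition is_tip x p : Prop :=
  p \in msupp x /\ forall q, q \in msupp x -> q != p -> gt p q.

(* [is_tip 0 p] never holds, so [x != 0] is implicit. *)
Definition tips X : set (qpath Q) := [set p | exists2 x, X x & is_tip x p].

Definition pths P : set KQ := [set pth K p | p in P].

Definition tip_ideal X : set KQ := ideal_gen (pths (tips X)).

Definition homogeneous x : Prop :=
  exists d, forall p, p \in msupp x -> plen p = d.

Definition uniform x : Prop :=
  x != 0 /\ exists v w, x = pth K (pvert v) * x * pth K (pvert w).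

Definition quadratic x : Prop := forall p, p \in msupp x -> plen p = 2.

Definition graded_ideal I : Prop :=
  exists2 X, X `<=` homogeneous & I = ideal_gen X.

Definition groebner_basis I G : Prop :=
  [/\ graded_ideal I, G `<=` I,
      forall x, G x -> homogeneous x /\ uniform x
    & tip_ideal G = tip_ideal I].

Definition strong_koszul I : Prop :=
  exists2 G, groebner_basis I G & G `<=` quadratic.

Definition quadratic_monomial_groebner I : Prop :=
  exists2 G, groebner_basis I G & G `<=` pths [set p | plen p = 2].

(* I_Mon; the algebra (KQ/I)_Mon is KQ/I_Mon. *)
Definition mon_ideal I : set KQ := tip_ideal I.

End Groebner.

Section Variety.
Variables (K : fieldType) (Q : quiver) (gt : rel (qpath Q)).
Variable T : {fset qpath Q}.
Local Notation KQ := (pathalg K Q).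

Definition T_paths : set (qpath Q) := [set t | t \in T].

Definition T_set : set KQ := pths T_paths.

Definition normal : set (qpath Q) := ~` tips gt (ideal_gen T_set).

(* The normal paths are those without subpath in T; in particular they
   depend neither on the field nor on the order. *)
Lemma normalE p : normal p <-> forall t q r, t \in T -> pmul3 q t r <> Some p.
Proof.
split.
  move=> np t q r tT e; apply: np; exists (pth K p).
    move=> J [J0 JD Jl Jr] TJ.
    have : J (pth K q * (pth K t * pth K r)).
      by apply: Jl; apply: Jr; apply: TJ; exists t.
    move: e; rewrite pth_mul /pmul3; case: (pmul t r) => //= u.
    by rewrite pth_mul => ->.
  split; first by rewrite msuppU oner_eq0 inE.
  by move=> q'; rewrite msuppU oner_eq0 inE => ->.
pose has_sub u := exists t q r, t \in T /\ pmul3 q t r = Some u.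
pose J : set (pathalg K Q) := [set x | forall u, u \in msupp x -> has_sub u].
have JD x y : J x -> J y -> J (x + y).
  by move=> Jx Jy u /(fsubsetP (msuppD_le _ _)); rewrite inE => /orP[/Jx|/Jy].
have J0 : J 0 by move=> u; rewrite msupp0 inE.
have Jsum (s : seq (qpath Q)) (F : qpath Q -> pathalg K Q) :
    (forall i, i \in s -> J (F i)) -> J (\sum_(i <- s) F i).
  by move=> JF; rewrite big_seq; elim/big_ind: _.
have JU c u : has_sub u -> J << c *g u >>.
  by move=> hu w /(fsubsetP msuppU_le); rewrite inE => /eqP ->.
have Jmul (x y : pathalg K Q) : (forall u w v, u \in msupp x -> w \in msupp y ->
    pmul u w = Some v -> has_sub v) -> J (x * y).
  move=> h; rewrite pathalg_mulE; apply: (Jsum) => u ux; apply: (Jsum) => w wy.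
  by case e: (pmul u w) => [v|] //=; apply: (JU); exact: h e.
move=> h [x Ix [px _]].
have [||t [q [r [tT e]]]] := Ix J _ _ p px; last exact: (h t q r tT).
  split=> // a y Jy; apply: (Jmul) => u w v uy wy e.
    have [t [q [r [tT]]]] := Jy w wy; rewrite /pmul3.
    case tr: (pmul t r) => [z|] //= qz.
    have := pmulA u q z; rewrite qz /= e.
    case uq: (pmul u q) => [q'|] //= /esym e'.
    by exists t, q', r; rewrite /pmul3 tr.
  have [t [q [r [tT]]]] := Jy u uy; rewrite /pmul3 pmulA.
  case qt: (pmul q t) => [z|] //= zr.
  have := pmulA z r w; rewrite zr /= e.
  case rw: (pmul r w) => [r'|] //= e'.
  by exists t, q, r'; rewrite /pmul3 pmulA qt.
move=> _ [t tT <-]; apply: (JU); exists t, (pvert (pstart t)), (pvert (pend t)).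
split => //; rewrite /pmul3.
have -> : pmul t (pvert (pend t)) = Some t by apply/eqP/pmulP; rewrite cats0.
by apply/eqP/pmulP.
Qed.

Definition normal2 (t : qpath Q) : {fset qpath Q} :=
  [fset n in paths_of_len Q 2 |
    [&& n \in normal, gt t n, pstart n == pstart t & pend n == pend t]].

Definition varidx : {fset qpath Q * qpath Q} :=
  [fset ((t, n) : (qpath Q * qpath Q)%type) | t in T, n in normal2 t].

(* A point X = (x_{t,n}); the dimension D is #|`varidx|. *)
Definition affpoint : Type := {ffun varidx -> K}.
HB.instance Definition _ := GRing.Zmodule.on affpoint.

(* t - sum_n x_{t,n} n, over any coefficient ring *)
Definition gelt (A : comNzRingType) (x : varidx -> A) (t : qpath Q)
    : pathalg A Q :=
  pth A t - \sum_(i : varidx | (val i).1 == t) x i *: pth A (val i).2.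

Definition G_set (X : affpoint) : set KQ := [set gelt X t | t in T_paths].

Definition corresponds (I : set KQ) (X : affpoint) : Prop :=
  I = ideal_gen (G_set X).

Definition GrAlg : set affpoint :=
  [set X | strong_koszul gt (ideal_gen (G_set X))].

(* The polynomials: R = KQ[y], whose coefficients are polynomials in the
   variables y_{t,n}, numbered through [enum_rank]. *)

Definition ypoly : comNzRingType := {mpoly K[#|{: varidx}|]}.
Definition yvar (i : varidx) : ypoly := 'X_(enum_rank i).
Definition yeval (X : affpoint) (f : ypoly) : K :=
  f.@[fun j => X (enum_val j)].

Local Notation R := (pathalg ypoly Q).

Definition helt (t : qpath Q) : R := gelt yvar t.

Definition simple_reduction (F F' : R) : Prop :=
  exists p q t r, [/\ F@_p != 0, t \in T, pmul3 q t r = Some p &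
    F' = F - F@_p *: pth _ p + F@_p *:
      \sum_(i : varidx | (val i).1 == t)
         yvar i *: (pth _ q * pth _ (val i).2 * pth _ r)].

Definition complete_reduction (F F' : R) : Prop :=
  clos_refl_trans R simple_reduction F F' /\
  forall F'', ~ simple_reduction F' F''.

(* t = ab and t' = bc *)
Definition overlap (t t' : qpath Q) (a b c : arrow Q) : Prop :=
  [/\ t \in T, t' \in T, pmul (parr a) (parr b) = Some t
    & pmul (parr b) (parr c) = Some t'].

Definition Ov (t t' : qpath Q) (a c : arrow Q) : R :=
  helt t * pth _ (parr c) - pth _ (parr a) * helt t'.

(* A choice of one complete reduction for each overlap; the arrows a, b, c
   are determined by t and t'. *)
Definition reduction_choice (red : qpath Q -> qpath Q -> R) : Prop :=
  forall t t' a b c, overlap t t' a b c ->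
    complete_reduction (Ov t t' a c) (red t t').

Definition I_poly (red : qpath Q -> qpath Q -> R) : set ypoly :=
  [set f | exists t t' a b c n, [/\ overlap t t' a b c,
     normal n, plen n = 3 & f = (red t t')@_n]].

Definition zero_set (S : set ypoly) : set affpoint :=
  [set X | forall f, S f -> yeval X f = 0].

End Variety.

Arguments T_paths {Q} T _.
Arguments T_set K {Q} T _.
Arguments normal K {Q} gt T _.

(* Main.v *)
Require Import Defs.
From Stdlib Require Import Relation_Operators.
From mathcomp Require Import all_boot all_order all_algebra finmap.
From mathcomp Require Import boolp classical_sets.
From mathcomp Require Import mpoly monalg zify.

(** The idea of the proof. Every statement is about the equality of the ideal of
    tips of [I] with the monomial ideal of [T], read in two ways: no tip of an
    element of [I] is a normal path, and every path of [T] is a tip.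

    Division ([division]): if every path of [T] is the tip of some element of an
    ideal [J], each element is, modulo [J], a combination of normal paths. Thus,
    if the tips of a graded ideal [I] generate [<T>], dividing [t] by [I] and
    keeping the terms parallel to [t] and of length 2 produces
    [g_t = t - sum x_{t,n} n] in [I], that is, a point [X] of the affine space.
    The [g_t] generate [I], since the remainder of an element of [I] modulo
    [<G(X)>] is a normal element of [I], hence zero; so they form a quadratic
    Groebner basis ([mon_ideal_point]). Two ideals with the same tips, one
    contained in the other, coincide for the same reason ([division_ideal]),
    which also gives the uniqueness of the monomial algebra.

    For the converses one has to see that no normal path becomes a tip of
    [<G(X)>]. This ideal is spanned by the multiples [q g_t r], with tip
    [q t r], and a new tip can arise only when the tips of several multiples
    cancel. If the difference of two multiples with the same tip is always a
    combination of multiples with smaller tips (confluence), a well-founded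
    induction excludes this ([span_lead]). For a strong Koszul algebra only
    quadratic elements matter, as these contain a Groebner basis, and there
    confluence is trivial because a path of length 2 is the tip of at most one
    multiple ([confluent_quadratic]). For a zero [X] of the overlap polynomials,
    two occurrences of [t] and [t'] in a path either coincide, are disjoint,
    where confluence holds by itself, or overlap in one arrow
    ([confluent_overlaps]). In the last case a complete reduction over the
    polynomial ring, evaluated at [X], writes [g_t c - a g_t'] as a combination
    of multiples with tips below [abc] plus a combination of normal paths whose
    coefficients are the values at [X] of the overlap polynomials, that is,
    zero ([complete_reduction_eval]).
    Read backwards, if no normal path is a tip, this remainder, being an element
    of [<G(X)>] supported on normal paths, vanishes: the overlap polynomials are
    zero at [X]. *)

Set Implicit Arguments.
Unset Strict Implicit.
Unset Printing Implicit Defensive.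

Import GRing.Theory.

Local Open Scope classical_set_scope.
Local Open Scope ring_scope.

Local Notation "g @_ k" := (monalg.mcoeff k g) : ring_scope.

(** * Paths and their products *)

Section PathCalculus.
Variable Q : quiver.
Implicit Types (p q r m : qpath Q).

Lemma qpath_eq p q : pstart p = pstart q -> parrows p = parrows q -> p = q.
Proof.
move=> h1 h2; apply: val_inj; move: h1 h2; rewrite /pstart /parrows.
by case: (val p) (val q) => [? ?] [? ?] /= -> ->.
Qed.

Lemma pmulE p q r : pmul p q = Some r ->
  [/\ pend p = pstart q, pstart r = pstart p, pend r = pend q
    & parrows r = parrows p ++ parrows q].
Proof.
move/eqP/pmulP => [h1 h2 h3]; split=> //.
by rewrite /pend h2 h3 walk_end_cat -/(pend p) h1.
Qed.

Lemma plen_pmul p q r : pmul p q = Some r -> plen r = (plen p + plen q)%N.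
Proof. by move/pmulE => [_ _ _ h]; rewrite /plen h size_cat. Qed.

Lemma plen0 p : plen p = 0%N -> p = pvert (pstart p).
Proof. by move/size0nil => h; apply: qpath_eq. Qed.

Lemma plen1 p : plen p = 1%N -> exists a, p = parr a.
Proof.
rewrite /plen; case E: (parrows p) => [|a [|]] // _; exists a; apply: qpath_eq.
  have : is_walk (pstart p) (parrows p) by exact: (valP p).
  by rewrite E /= andbT => /eqP <-.
by rewrite E.
Qed.

Lemma pmul_vl p : pmul (pvert (pstart p)) p = Some p.
Proof. by apply/eqP/pmulP; split. Qed.

Lemma pmul_vr p : pmul p (pvert (pend p)) = Some p.
Proof. by apply/eqP/pmulP; split=> //; rewrite cats0. Qed.

Lemma pmul0l m q p : plen m = 0%N -> pmul m q = Some p -> q = p.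
Proof.
move=> m0 /pmulE [h1 h2 _ h3]; apply: qpath_eq.
  by rewrite h2 -h1 (plen0 m0).
by rewrite h3 (size0nil m0).
Qed.

Lemma pmul0r m q p : plen m = 0%N -> pmul q m = Some p -> q = p.
Proof.
move=> m0 /pmulE [h1 h2 _ h3]; apply: qpath_eq; first by rewrite h2.
by rewrite h3 (size0nil m0) cats0.
Qed.

(** Levi's lemma: two factorizations of one path have a common refinement;
    this is what reduces the comparison of two reductions of a path to three
    cases. *)
Lemma path_levi p q p' q' u : pmul p q = Some u -> pmul p' q' = Some u ->
  (plen p <= plen p')%N ->
  exists m, pmul p m = Some p' /\ pmul m q' = Some q.
Proof.
move=> /pmulE [e1 s1 t1 a1] /pmulE [e2 s2 t2 a2] le.
have Ea : parrows p' = parrows p ++ drop (plen p) (parrows p').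
  have -> : parrows p = take (plen p) (parrows p').
    by rewrite -[LHS](take_size_cat (parrows q) erefl) -a1 a2 takel_cat.
  by rewrite cat_take_drop.
have w2 : is_walk (walk_end (pstart p) (parrows p)) (drop (plen p) (parrows p')).
  have : is_walk (pstart p') (parrows p') by exact: (valP p').
  by rewrite {1}Ea -s2 s1 is_walk_cat => /andP[].
pose m := @QPath Q (walk_end (pstart p) (parrows p), drop (plen p) (parrows p')) w2.
have pm : pmul p m = Some p' by apply/eqP/pmulP; split=> //; rewrite -s1 s2.
exists m; split=> //; apply/eqP/pmulP; split=> //.
  by have [_ _ <- _] := pmulE pm.
have /(congr1 (drop (plen p))) : parrows p ++ parrows q = parrows p' ++ parrows q'.
  by rewrite -a1 a2.
rewrite drop_size_cat // drop_cat => ->; case: ltnP => // ge.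
rewrite /m /parrows /= -/(parrows p') -/(parrows q').
have -> : plen p = plen p' by apply/eqP; rewrite eqn_leq le.
by rewrite subnn drop0 drop_size.
Qed.

End PathCalculus.


(** * Rings with a basis of paths *)

(** The properties of a path algebra on which everything below rests: the
    paths form a basis over [A], scalars are central and paths multiply by
    concatenation or to zero. The same statements serve for coefficients in the
    field and in the polynomial ring of the variables [y]. *)
Record path_basis (A : comNzRingType) (Q : quiver) (V : pzRingType)
    (sc : A -> V -> V) (mono : qpath Q -> V) (coef : V -> qpath Q -> A)
    (supp : V -> {fset qpath Q}) : Prop := PathBasis {
  pb_coefD : forall x y p, coef (x + y) p = coef x p + coef y p;
  pb_coefZ : forall c x p, coef (sc c x) p = c * coef x p;
  pb_coef_mono : forall p q, coef (mono p) q = (p == q)%:R;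
  pb_supp : forall x p, (p \in supp x) = (coef x p != 0);
  pb_expand : forall x, x = \sum_(p <- supp x) sc (coef x p) (mono p);
  pb_mul : forall p q, mono p * mono q = oapp mono 0 (pmul p q);
  pb_scaleAl : forall c x y, sc c (x * y) = sc c x * y;
  pb_scaleAr : forall c x y, sc c (x * y) = x * sc c y
}.

Section PathBasis.
Variables (A : comNzRingType) (Q : quiver) (V : pzRingType).
Variables (sc : A -> V -> V) (mono : qpath Q -> V) (coef : V -> qpath Q -> A).
Variables (supp : V -> {fset qpath Q}) (B : path_basis sc mono coef supp).
Local Notation "c *: x" := (sc c x) : ring_scope.
Implicit Types (x y : V) (p q r : qpath Q) (c : A).

Lemma pb_coef0 p : coef 0 p = 0.
Proof. by apply: (addrI (coef 0 p)); rewrite -(pb_coefD B) !addr0. Qed.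

Lemma pb_coefN x p : coef (- x) p = - coef x p.
Proof. by apply: (addrI (coef x p)); rewrite -(pb_coefD B) !subrr pb_coef0. Qed.

Lemma pb_coefB x y p : coef (x - y) p = coef x p - coef y p.
Proof. by rewrite (pb_coefD B) pb_coefN. Qed.

Lemma pb_coef_sum (J : Type) (s : seq J) (P : pred J) (F : J -> V) p :
  coef (\sum_(j <- s | P j) F j) p = \sum_(j <- s | P j) coef (F j) p.
Proof. by apply: (big_morph (coef^~ p)) => [x y|]; rewrite ?(pb_coefD B) ?pb_coef0. Qed.

Lemma pb_coef_inj x y : (forall p, coef x p = coef y p) -> x = y.
Proof.
move=> e; rewrite (pb_expand B x) (pb_expand B y).
have -> : supp x = supp y by apply/fsetP => p; rewrite !(pb_supp B) e.
by apply: eq_bigr => p _; rewrite e.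
Qed.

Lemma pscaleDr c x y : c *: (x + y) = c *: x + c *: y.
Proof. by apply: pb_coef_inj => p; rewrite !(pb_coefD B, pb_coefZ B) mulrDr. Qed.

Lemma pscaleDl c d x : (c + d) *: x = c *: x + d *: x.
Proof. by apply: pb_coef_inj => p; rewrite !(pb_coefD B, pb_coefZ B) mulrDl. Qed.

Lemma pscaler0 c : c *: 0 = 0.
Proof. by apply: pb_coef_inj => p; rewrite (pb_coefZ B) pb_coef0 mulr0. Qed.

Lemma pscale0r x : 0 *: x = 0.
Proof. by apply: pb_coef_inj => p; rewrite (pb_coefZ B) pb_coef0 mul0r. Qed.

Lemma pscale1r x : 1 *: x = x.
Proof. by apply: pb_coef_inj => p; rewrite (pb_coefZ B) mul1r. Qed.

Lemma pscaleA c d x : c *: (d *: x) = (c * d) *: x.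
Proof. by apply: pb_coef_inj => p; rewrite !(pb_coefZ B) mulrA. Qed.

Lemma pscaleN1r x : (- 1) *: x = - x.
Proof. by apply: pb_coef_inj => p; rewrite (pb_coefZ B) mulN1r pb_coefN. Qed.

Lemma mono_neq0 p : mono p <> 0.
Proof.
move/(congr1 (coef^~ p)); rewrite (pb_coef_mono B) eqxx pb_coef0 => /eqP.
by rewrite oner_eq0.
Qed.

Lemma mono_inj : injective mono.
Proof.
move=> p q /(congr1 (coef^~ p)); rewrite !(pb_coef_mono B) eqxx.
by case: eqVneq => // _ /eqP; rewrite oner_eq0.
Qed.

Lemma pscalerN c x : c *: (- x) = - (c *: x).
Proof.
by apply: pb_coef_inj => p; rewrite (pb_coefZ B) !pb_coefN (pb_coefZ B) mulrN.
Qed.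

(** Induction on the support: only the paths occurring in [x] have to be
    treated, which is how supports of products are computed below. *)
Lemma path_basis_ind (E : set V) x :
  E 0 -> (forall y z, E y -> E z -> E (y + z)) ->
  (forall c p, coef x p != 0 -> E (c *: mono p)) -> E x.
Proof.
move=> E0 ED EU; rewrite (pb_expand B x) big_seq; elim/big_ind: _ => // p.
by rewrite (pb_supp B); exact: EU.
Qed.

Lemma mono_mulP p q r : pmul p q = Some r <-> mono p * mono q = mono r.
Proof.
rewrite (pb_mul B); case: (pmul p q) => [u|] /=; split=> //.
- by case=> ->.
- by move/mono_inj => ->.
- by move/esym/mono_neq0.
Qed.

Lemma pmul3P q t r p : pmul3 q t r = Some p <-> mono q * mono t * mono r = mono p.
Proof.
rewrite -mulrA /pmul3 (pb_mul B t r); case: (pmul t r) => [u|] /=.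
  exact: mono_mulP.
by split=> //; rewrite mulr0 => /esym/mono_neq0.
Qed.

Lemma mono_mul_case p q : mono p * mono q = 0 \/ exists r, mono p * mono q = mono r.
Proof. by rewrite (pb_mul B); case: (pmul p q) => [r|] /=; [right; exists r|left]. Qed.

Lemma mono_mul3_case q t r :
  mono q * mono t * mono r = 0 \/ exists p, mono q * mono t * mono r = mono p.
Proof.
case: (mono_mul_case q t) => [->|[u ->]]; first by left; rewrite mul0r.
exact: mono_mul_case.
Qed.

Lemma mono_verts p :
  mono (pvert (pstart p)) * mono p * mono (pvert (pend p)) = mono p.
Proof. by apply/pmul3P; rewrite /pmul3 pmul_vr /= pmul_vl. Qed.

(** Every element is a combination of paths, so absorption of paths and
    scalars already makes a subgroup an ideal. *)
Lemma two_sided_ideal_mono (E : set V) :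
  E 0 -> (forall x y, E x -> E y -> E (x + y)) -> (forall c x, E x -> E (c *: x)) ->
  (forall p x, E x -> E (mono p * x)) -> (forall p x, E x -> E (x * mono p)) ->
  two_sided_ideal E.
Proof.
move=> E0 ED EZ El Er; split=> // a x Ex.
  apply: (@path_basis_ind [set a | E (a * x)] a) => /= [|y z|c p _].
  - by rewrite mul0r.
  - by rewrite mulrDl; exact: ED.
  - by rewrite -(pb_scaleAl B); apply/EZ/El.
apply: (@path_basis_ind [set a | E (x * a)] a) => /= [|y z|c p _].
- by rewrite mulr0.
- by rewrite mulrDr; exact: ED.
- by rewrite -(pb_scaleAr B); apply/EZ/Er.
Qed.

Lemma ideal_scale (E : set V) c x : two_sided_ideal E -> E x -> E (c *: x).
Proof. by move=> [_ _ El _] Ex; rewrite -[x]mul1r (pb_scaleAl B); exact: El. Qed.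

Lemma ideal_opp (E : set V) x : two_sided_ideal E -> E x -> E (- x).
Proof. by move=> idE Ex; rewrite -pscaleN1r; exact: ideal_scale. Qed.

Lemma ideal_sub (E : set V) x y : two_sided_ideal E -> E x -> E y -> E (x - y).
Proof. by move=> idE Ex Ey; case: (idE) => _ ED _ _; apply: ED => //; exact: ideal_opp. Qed.


End PathBasis.

Lemma pmul3E (Q : quiver) (q t r p : qpath Q) : pmul3 q t r = Some p ->
  [/\ pend q = pstart t, pend t = pstart r, pstart p = pstart q,
      pend p = pend r & plen p = (plen q + plen t + plen r)%N].
Proof.
rewrite /pmul3; case tr: (pmul t r) => [u|] //= qu.
have [h1 h2 h3 _] := pmulE qu; have [k1 k2 k3 _] := pmulE tr.
by rewrite h1 k2 k1 h2 h3 k3 (plen_pmul qu) (plen_pmul tr) addnA; split.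
Qed.

Lemma pmul3_ex (Q : quiver) (q t r : qpath Q) :
  pend q = pstart t -> pend t = pstart r -> exists p, pmul3 q t r = Some p.
Proof.
move=> qt /pmul_ex [u tr]; rewrite /pmul3 tr; apply: pmul_ex.
by have [_ -> _ _] := pmulE tr.
Qed.

Section MakeBasis.
Variables (A : comNzRingType) (Q : quiver) (V : pzRingType).
Variables (sc : A -> V -> V) (mono : qpath Q -> V) (coef : V -> qpath Q -> A).
Variables (supp : V -> {fset qpath Q}).
Local Notation "c *: x" := (sc c x) : ring_scope.

(** Centrality of the scalars extends by bilinearity from multiples of paths. *)
Lemma path_basis_bilinear :
  (forall x y p, coef (x + y) p = coef x p + coef y p) ->
  (forall c x p, coef (c *: x) p = c * coef x p) ->
  (forall p q, coef (mono p) q = (p == q)%:R) ->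
  (forall x p, (p \in supp x) = (coef x p != 0)) ->
  (forall x, x = \sum_(p <- supp x) coef x p *: mono p) ->
  (forall a b p q, (a *: mono p) * (b *: mono q) =
     (a * b) *: oapp mono 0 (pmul p q)) ->
  path_basis sc mono coef supp.
Proof.
move=> cD cZ cm sE ex mU.
have inj x y : (forall p, coef x p = coef y p) -> x = y.
  move=> e; rewrite (ex x) (ex y).
  have -> : supp x = supp y by apply/fsetP => p; rewrite !sE e.
  by apply: eq_bigr => p _; rewrite e.
have sD c x y : c *: (x + y) = c *: x + c *: y.
  by apply: inj => p; rewrite !(cD, cZ) mulrDr.
have s0 c : c *: 0 = 0 by apply: (addrI (c *: 0)); rewrite -sD !addr0.
have sA a b x : a *: (b *: x) = (a * b) *: x.
  by apply: inj => p; rewrite !cZ mulrA.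
have s1 x : 1 *: x = x by apply: inj => p; rewrite cZ mul1r.
have ind (E : set V) x : E 0 -> (forall y z, E y -> E z -> E (y + z)) ->
    (forall c p, E (c *: mono p)) -> E x.
  by move=> E0 ED EU; rewrite (ex x); elim/big_ind: _.
split=> //.
- by move=> p q; rewrite -[mono p]s1 -[mono q]s1 mU mulr1 s1.
- move=> c x y; apply: (ind [set x | c *: (x * y) = c *: x * y]) => /=.
  + by rewrite mul0r s0 mul0r.
  + by move=> u w hu hw; rewrite mulrDl !sD hu hw mulrDl.
  move=> a p; apply: (ind [set y | c *: (a *: mono p * y) = c *: (a *: mono p) * y]) => /=.
  + by rewrite !mulr0 s0.
  + by move=> u w hu hw; rewrite !mulrDr sD hu hw.
  by move=> b q; rewrite sA !mU sA mulrA.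
- move=> c x y; apply: (ind [set x | c *: (x * y) = x * (c *: y)]) => /=.
  + by rewrite !mul0r s0.
  + by move=> u w hu hw; rewrite !mulrDl sD hu hw.
  move=> a p; apply: (ind [set y | c *: (a *: mono p * y) = a *: mono p * (c *: y)]) => /=.
  + by rewrite s0 mulr0 s0.
  + by move=> u w hu hw; rewrite !mulrDr !sD mulrDr hu hw.
  by move=> b q; rewrite sA !mU sA mulrCA.
Qed.
End MakeBasis.

(** Coefficients and supports in the form that [path_basis] asks for. *)
Definition pcoef (A : comNzRingType) (Q : quiver) (x : pathalg A Q) p : A := x@_p.
Definition psupp (A : comNzRingType) (Q : quiver) (x : pathalg A Q) := msupp x.

Lemma pathalg_basis (A : comNzRingType) (Q : quiver) :
  @path_basis A Q (pathalg A Q) *:%R (@pth A Q)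
    (@pcoef A Q) (@psupp A Q).
Proof.
have UE (a : A) (p : qpath Q) : << a *g p >> = a *: pth A p.
  apply/(malgP _ _).1 => q; rewrite mcoeffZ.
  apply: etrans (mcoeffU _ _ _) _; apply/esym.
  by apply: etrans (congr1 (fun z => a * z) (mcoeffU _ _ _)) _; rewrite mulrnAr mulr1.
apply: path_basis_bilinear.
- move=> x y p; exact: mcoeffD.
- move=> c x p; exact: mcoeffZ.
- move=> p q; exact: mcoeffU.
- by move=> x p; rewrite /pcoef mcoeff_neq0.
- move=> x; apply: etrans (monalgE x) _; apply: eq_bigr => p _; exact: UE.
move=> a b p q; rewrite -!UE pathalg_mulE pamulUU.
case: (pmul p q) => [r|] /=; first exact: UE.
by rewrite scaler0.
Qed.
Section Components.
Variables (A : comNzRingType) (Q : quiver) (V : pzRingType).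
Variables (sc : A -> V -> V) (mono : qpath Q -> V) (coef : V -> qpath Q -> A).
Variables (supp : V -> {fset qpath Q}) (B : path_basis sc mono coef supp).
Local Notation "c *: x" := (sc c x) : ring_scope.
Implicit Types (x y : V) (p q r t u : qpath Q) (c : A).

Lemma coef_comb (s : {fset qpath Q}) (f : qpath Q -> A) p :
  coef (\sum_(q <- s) f q *: mono q) p = if p \in s then f p else 0.
Proof.
have E q : coef (f q *: mono q) p = if q == p then f q else 0.
  by rewrite (pb_coefZ B) (pb_coef_mono B); case: eqP; rewrite ?mulr1 ?mulr0.
rewrite (pb_coef_sum B); under eq_bigr => q _ do rewrite E.
have [ps|ps] := boolP (p \in s).
  rewrite (bigD1_seq p ps (fset_uniq s)) /= eqxx big1 ?addr0 // => q.
  by move/negPf ->.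
rewrite big1_seq // => q /= qs; case: eqP => // qp.
by move: ps; rewrite -qp qs.
Qed.

(** * Supports of products *)

(** The support of a product comes from the supports of the factors. When one
    factor is a path, coefficients are even preserved ([coef_mull_eq]): paths
    can be cancelled, so no two terms of [x] meet in the product. *)
Lemma coef_mull p x u : coef (mono p * x) u != 0 ->
  exists2 q, coef x q != 0 & pmul p q = Some u.
Proof.
pose E : set V := [set y | coef (mono p * y) u != 0 ->
  exists2 q, coef x q != 0 & pmul p q = Some u].
apply: (path_basis_ind B (E := E)); rewrite /E /=.
- by rewrite mulr0 (pb_coef0 B) eqxx.
- move=> y z Ey Ez; rewrite mulrDr (pb_coefD B) => h.
  by have [/eqP e|] := boolP (coef (mono p * y) u == 0); [apply: Ez; move: h; rewrite e add0r|apply: Ey].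
move=> c q xq; rewrite -(pb_scaleAr B) (pb_coefZ B) (pb_mul B).
case e: (pmul p q) => [v|] /=; last by rewrite (pb_coef0 B) mulr0 eqxx.
by rewrite (pb_coef_mono B); case: (eqVneq v u) => [<- _|_]; [exists q|rewrite mulr0 eqxx].
Qed.

Lemma coef_mulr p x u : coef (x * mono p) u != 0 ->
  exists2 q, coef x q != 0 & pmul q p = Some u.
Proof.
pose E : set V := [set y | coef (y * mono p) u != 0 ->
  exists2 q, coef x q != 0 & pmul q p = Some u].
apply: (path_basis_ind B (E := E)); rewrite /E /=.
- by rewrite mul0r (pb_coef0 B) eqxx.
- move=> y z Ey Ez; rewrite mulrDl (pb_coefD B) => h.
  by have [/eqP e|] := boolP (coef (y * mono p) u == 0); [apply: Ez; move: h; rewrite e add0r|apply: Ey].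
move=> c q xq; rewrite -(pb_scaleAl B) (pb_coefZ B) (pb_mul B).
case e: (pmul q p) => [v|] /=; last by rewrite (pb_coef0 B) mulr0 eqxx.
by rewrite (pb_coef_mono B); case: (eqVneq v u) => [<- _|_]; [exists q|rewrite mulr0 eqxx].
Qed.

Lemma coef_mul3 q x r u : coef (mono q * x * mono r) u != 0 ->
  exists2 s, coef x s != 0 & pmul3 q s r = Some u.
Proof.
move/coef_mulr => [v /coef_mull [s xs e1] e2]; exists s => //.
by rewrite /pmul3 pmulA e1.
Qed.

Lemma coef_mull_eq p x q u : pmul p q = Some u -> coef (mono p * x) u = coef x q.
Proof.
move=> e; apply: (path_basis_ind B (E := [set y |
  coef (mono p * y) u = coef y q])) => /= [|y z Ey Ez|c s _].
- by rewrite mulr0 !(pb_coef0 B).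
- by rewrite mulrDr !(pb_coefD B) Ey Ez.
rewrite -(pb_scaleAr B) !(pb_coefZ B); congr (_ * _).
rewrite (pb_coef_mono B); case: eqVneq => [->|ne].
  by rewrite ((mono_mulP B _ _ _).1 e) (pb_coef_mono B) eqxx.
rewrite (pb_mul B); case ps: (pmul p s) => [v|] /=; last by rewrite (pb_coef0 B).
rewrite (pb_coef_mono B); case: eqVneq => // vu; case/eqP: ne.
have [e1 _ _ a1] := pmulE e; have [e2 _ _ a2] := pmulE ps.
apply: qpath_eq; first by rewrite -e1 -e2.
by move: a2; rewrite vu a1 => /eqP; rewrite eqseq_cat // eqxx => /eqP.
Qed.

Lemma coef_mulr_eq p x q u : pmul q p = Some u -> coef (x * mono p) u = coef x q.
Proof.
move=> e; apply: (path_basis_ind B (E := [set y |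
  coef (y * mono p) u = coef y q])) => /= [|y z Ey Ez|c s _].
- by rewrite mul0r !(pb_coef0 B).
- by rewrite mulrDl !(pb_coefD B) Ey Ez.
rewrite -(pb_scaleAl B) !(pb_coefZ B); congr (_ * _).
rewrite (pb_coef_mono B); case: eqVneq => [->|ne].
  by rewrite ((mono_mulP B _ _ _).1 e) (pb_coef_mono B) eqxx.
rewrite (pb_mul B); case ps: (pmul s p) => [v|] /=; last by rewrite (pb_coef0 B).
rewrite (pb_coef_mono B); case: eqVneq => // vu; case/eqP: ne.
have [_ e1 _ a1] := pmulE e; have [_ e2 _ a2] := pmulE ps.
apply: qpath_eq; first by rewrite -e1 -e2 vu.
have hs : size (parrows q) = size (parrows s).
  have /eqP := congr1 size a1; rewrite -vu a2 !size_cat eqn_add2r.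
  by move/eqP.
by move: a2; rewrite vu a1 => /eqP; rewrite eqseq_cat // => /andP[/eqP].
Qed.

Lemma coef_mul3_eq q x r t p : pmul3 q t r = Some p ->
  coef (mono q * x * mono r) p = coef x t.
Proof.
rewrite /pmul3 pmulA; case qt: (pmul q t) => [z|] //= zr.
by rewrite (coef_mulr_eq _ zr) (coef_mull_eq _ qt).
Qed.

Lemma parallel_uniform x v w :
  (forall p, coef x p != 0 -> pstart p = v /\ pend p = w) ->
  x = mono (pvert v) * x * mono (pvert w).
Proof.
move=> hx; apply: (pb_coef_inj B) => p.
have [/andP[/eqP <- /eqP <-]|h] := boolP ((pstart p == v) && (pend p == w)).
  apply/esym/coef_mul3_eq; apply/(pmul3P B); exact: mono_verts B p.
have [->|/hx [ps pe]] := eqVneq (coef x p) 0; last by rewrite ps pe !eqxx in h.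
apply/esym/eqP; apply: contraNT h => /coef_mul3 [s _ /pmul3E].
by move=> [_ _ -> -> _]; rewrite !eqxx.
Qed.

(** * Homogeneous components *)

Definition component (C : pred (qpath Q)) x : V :=
  \sum_(p <- supp x) (if C p then coef x p else 0) *: mono p.

Lemma coef_component C x p : coef (component C x) p = if C p then coef x p else 0.
Proof.
rewrite /component coef_comb (pb_supp B) if_neg.
by case: eqP => // ->; rewrite if_same.
Qed.

Lemma componentD C x y : component C (x + y) = component C x + component C y.
Proof.
apply: (pb_coef_inj B) => p; rewrite !(pb_coefD B) !coef_component (pb_coefD B).
by case: (C p); rewrite ?addr0.
Qed.

Lemma componentZ C c x : component C (c *: x) = c *: component C x.
Proof.
apply: (pb_coef_inj B) => p; rewrite !(pb_coefZ B) !coef_component (pb_coefZ B).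
by case: (C p); rewrite ?mulr0.
Qed.

Lemma component0 C : component C 0 = 0.
Proof. by apply: (pb_coef_inj B) => p; rewrite coef_component (pb_coef0 B) if_same. Qed.

Lemma component_mono C p : component C (mono p) = if C p then mono p else 0.
Proof.
apply: (pb_coef_inj B) => q; rewrite coef_component (pb_coef_mono B).
have [<-|ne] := eqVneq p q.
  by case: (C p); rewrite ?(pb_coef_mono B) ?(pb_coef0 B) ?eqxx.
by case: (C p); rewrite ?(pb_coef_mono B) ?(pb_coef0 B) ?(negPf ne) if_same.
Qed.

Definition block d (v w : vertex Q) : pred (qpath Q) :=
  [pred p | [&& plen p == d, pstart p == v & pend p == w]].

Lemma component_mull d v w p x : component (block d v w) (mono p * x) =
  if (pstart p == v) && (plen p <= d)%N
  then mono p * component (block (d - plen p)%N (pend p) w) x else 0.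
Proof.
pose E : set V := [set x | component (block d v w) (mono p * x) =
  if (pstart p == v) && (plen p <= d)%N
  then mono p * component (block (d - plen p)%N (pend p) w) x else 0].
apply: (path_basis_ind B (E := E)); rewrite /E /=.
- by rewrite mulr0 !component0 mulr0 if_same.
- move=> y z Ey Ez; rewrite mulrDr !componentD Ey Ez mulrDr.
  by case: ifP; rewrite ?addr0.
move=> c q _; rewrite -(pb_scaleAr B) !componentZ -(pb_scaleAr B) component_mono.
have -> (b : bool) y : (if b then c *: y else 0) = c *: (if b then y else 0).
  by case: b; rewrite ?(pscaler0 B).
congr (_ *: _); rewrite (pb_mul B); case e: (pmul p q) => [u|] /=; last first.
  by rewrite component0 (fun_if (fun y => mono p * y)) (pb_mul B) e mulr0 !if_same.
rewrite component_mono (fun_if (fun y => mono p * y)) (pb_mul B) e mulr0 /block /=.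
have [<- -> -> _] := pmulE e; rewrite (plen_pmul e) eqxx /=.
case: leqP => [le|lt]; last first.
  by rewrite andbF gtn_eqF //; apply: leq_trans lt (leq_addr _ _).
by rewrite andbT -(eqn_add2l (plen p) (plen q)) subnKC //; case: (pstart p == v); rewrite ?andbF.
Qed.

Lemma component_mulr d v w p x : component (block d v w) (x * mono p) =
  if (pend p == w) && (plen p <= d)%N
  then component (block (d - plen p)%N v (pstart p)) x * mono p else 0.
Proof.
pose E : set V := [set x | component (block d v w) (x * mono p) =
  if (pend p == w) && (plen p <= d)%N
  then component (block (d - plen p)%N v (pstart p)) x * mono p else 0].
apply: (path_basis_ind B (E := E)); rewrite /E /=.
- by rewrite mul0r !component0 mul0r if_same.
- move=> y z Ey Ez; rewrite mulrDl !componentD Ey Ez mulrDl.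
  by case: ifP; rewrite ?addr0.
move=> c q _; rewrite -(pb_scaleAl B) !componentZ -(pb_scaleAl B) component_mono.
have -> (b : bool) y : (if b then c *: y else 0) = c *: (if b then y else 0).
  by case: b; rewrite ?(pscaler0 B).
congr (_ *: _); rewrite (pb_mul B); case e: (pmul q p) => [u|] /=; last first.
  by rewrite component0 (fun_if (fun y => y * mono p)) (pb_mul B) e mul0r !if_same.
rewrite component_mono (fun_if (fun y => y * mono p)) (pb_mul B) e mul0r /block /=.
have [-> -> -> _] := pmulE e; rewrite (plen_pmul e) eqxx andbT /=.
case: leqP => [le|lt]; last first.
  by rewrite andbF gtn_eqF //; apply: leq_trans lt (leq_addl _ _).
by rewrite andbT -(eqn_add2r (plen p) (plen q)) subnK //; case: (pend p == w); rewrite ?andbF ?andbT.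
Qed.

Lemma ideal_gen_ideal (X : set V) : two_sided_ideal (ideal_gen X).
Proof.
split=> [J [] //|x y Ix Iy J idJ XJ|a x Ix J idJ XJ|a x Ix J idJ XJ].
- by case: (idJ) => _ JD _ _; apply: JD; [apply: Ix|apply: Iy].
- by case: (idJ) => _ _ Jl _; apply: Jl; apply: Ix.
- by case: (idJ) => _ _ _ Jr; apply: Jr; apply: Ix.
Qed.

Lemma sub_ideal_gen (X : set V) : X `<=` ideal_gen X.
Proof. by move=> x Xx J _; apply. Qed.

(** An ideal generated by homogeneous elements is the direct sum of its
    blocks: the elements with all blocks in it form an ideal. *)
Lemma ideal_gen_block (X : set V) d v w x :
  (forall y, X y -> exists d', forall p, coef y p != 0 -> plen p = d') ->
  ideal_gen X x -> ideal_gen X (component (block d v w) x).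
Proof.
move=> homX; set I := ideal_gen X.
have idI : two_sided_ideal I := ideal_gen_ideal X.
have [I0 ID Il Ir] := idI.
move=> Ix; move: d v w.
suff : [set x | forall d v w, I (component (block d v w) x)] x by [].
apply: Ix.
  apply: (two_sided_ideal_mono B) => /=.
  - by move=> d v w; rewrite component0.
  - by move=> y z hy hz d v w; rewrite componentD; apply: ID.
  - by move=> c y hy d v w; rewrite componentZ; exact: (ideal_scale B _ idI).
  - by move=> p y hy d v w; rewrite component_mull; case: ifP => // _; apply: Il.
  - by move=> p y hy d v w; rewrite component_mulr; case: ifP => // _; apply: Ir.
move=> y Xy d v w; have [d' hd] := homX y Xy.
have [dd|ne] := eqVneq d d'; last first.
  suff -> : component (block d v w) y = 0 by [].
  apply: (pb_coef_inj B) => p; rewrite coef_component (pb_coef0 B) /block /=.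
  case: (eqVneq (coef y p) 0) => [->|/hd ->]; first by rewrite if_same.
  by rewrite eq_sym (negPf ne).
suff -> : component (block d v w) y = mono (pvert v) * y * mono (pvert w).
  by apply: Ir; apply: Il; exact: sub_ideal_gen.
apply: (pb_coef_inj B) => p; rewrite coef_component /block /=.
have [/andP[/eqP <- /eqP <-]|h] := boolP ((pstart p == v) && (pend p == w)).
  rewrite andbT; have := pmul3P B (pvert (pstart p)) p (pvert (pend p)) p.
  move=> [_ /(_ (mono_verts B p)) /coef_mul3_eq ->].
  by rewrite dd; case: (eqVneq (coef y p) 0) => [->|/hd ->]; rewrite ?if_same ?eqxx.
rewrite andbF; apply/esym/eqP; apply: contraNT h => /coef_mul3 [s _] /pmul3E.
by move=> [_ _ -> -> _]; rewrite !eqxx.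
Qed.

(** * Monomial ideals *)

(** Elements whose whole support consists of multiples of [P] form an ideal, so
    membership in a monomial ideal can be read off each path separately. *)
Lemma ideal_gen_monomial (P : set (qpath Q)) x u :
  ideal_gen [set mono p | p in P] x -> coef x u != 0 ->
  exists t q r, P t /\ pmul3 q t r = Some u.
Proof.
move=> Ix; move: u.
suff : [set x | forall u, coef x u != 0 ->
    exists t q r, P t /\ pmul3 q t r = Some u] x by [].
apply: Ix.
  apply: (two_sided_ideal_mono B) => /=.
  - by move=> u; rewrite (pb_coef0 B) eqxx.
  - move=> y z hy hz u; rewrite (pb_coefD B) => h.
    have [/eqP e|] := boolP (coef y u == 0); last exact: hy.
    by apply: hz; move: h; rewrite e add0r.
  - move=> c y hy u; rewrite (pb_coefZ B) => h; apply: hy.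
    by apply: contraNneq h => ->; rewrite mulr0.
  - move=> p y hy u /coef_mull [s /hy [t [q [r [Pt e]]]] e'].
    move: e; rewrite /pmul3; case tr: (pmul t r) => [z|] //= qz.
    have := pmulA p q z; rewrite qz /= e'.
    case pq: (pmul p q) => [q'|] //= h; exists t, q', r.
    by rewrite /pmul3 tr /= -h.
  - move=> p y hy u /coef_mulr [s /hy [t [q [r [Pt e]]]] e'].
    move: e; rewrite /pmul3 pmulA; case qt: (pmul q t) => [z|] //= zr.
    have := pmulA z r p; rewrite zr /= e'.
    case rp: (pmul r p) => [r'|] //= h; exists t, q, r'.
    by rewrite /pmul3 pmulA qt /= h.
move=> _ [t Pt <-] u; rewrite (pb_coef_mono B); case: (eqVneq t u) => [<- _|_]; last by rewrite eqxx.
exists t, (pvert (pstart t)), (pvert (pend t)); split=> //.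
by apply/(pmul3P B)/(mono_verts B).
Qed.

Lemma monomial_multiple (P : set (qpath Q)) t q r p :
  P t -> pmul3 q t r = Some p -> ideal_gen [set mono p | p in P] (mono p).
Proof.
move=> Pt /(pmul3P B) <-; have [_ _ Il Ir] := ideal_gen_ideal [set mono p | p in P].
by apply: Ir; apply: Il; apply: sub_ideal_gen; exists t.
Qed.

End Components.
(** * Orders on paths *)

Section Order.
Variables (Q : quiver) (gt : rel (qpath Q)) (adm : length_admissible gt).
Implicit Types (p q r t u : qpath Q).

Lemma gt_trans p q r : gt p q -> gt q r -> gt p r.
Proof. exact: (la_trans adm). Qed.

Lemma gt_asym p q : gt p q -> gt q p -> False.
Proof. by move=> pq qp; have := gt_trans pq qp; rewrite (la_irr adm). Qed.

Lemma gt_neq p q : gt p q -> p != q.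
Proof. by move=> pq; apply: contraTneq pq => ->; rewrite (la_irr adm). Qed.

Lemma gt_mul3 q r t s p u :
  pmul3 q t r = Some p -> pmul3 q s r = Some u -> gt t s -> gt p u.
Proof.
rewrite /pmul3; case tr: (pmul t r) => [x|] //= qx.
case sr: (pmul s r) => [y|] //= qy ts.
by apply: (la_mull adm qx qy); apply: (la_mulr adm tr sr).
Qed.

(** The order is a well-order, given by least elements of nonempty sets. *)
Lemma gt_ind (P : qpath Q -> Prop) :
  (forall p, (forall q, gt p q -> P q) -> P p) -> forall p, P p.
Proof.
move=> IH p; apply: contrapT => nP.
have [|m nPm least] := @la_least _ _ adm [set p | ~ P p]; first by exists p.
apply: nPm; apply: IH => q mq; apply: contrapT => nPq.
by apply: (gt_asym mq); apply: least => //; rewrite eq_sym (gt_neq mq).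
Qed.

Lemma seq_max (s : seq (qpath Q)) : s != [::] ->
  exists2 m, m \in s & forall q, q \in s -> q != m -> gt m q.
Proof.
elim: s => [|a s IH] // _; have [->|ne] := eqVneq s [::].
  by exists a; rewrite ?inE // => q; rewrite inE => /eqP ->; rewrite eqxx.
have [m ms hm] := IH ne; have [am|am] := boolP (gt a m).
  exists a; rewrite ?inE ?eqxx // => q; rewrite inE => /orP[/eqP ->|qs _].
    by rewrite eqxx.
  by have [->//|/(hm q qs)] := eqVneq q m; exact: gt_trans am.
exists m; rewrite ?inE ?ms ?orbT // => q; rewrite inE => /orP[/eqP -> h|].
  by have := la_total adm h; rewrite (negPf am).
exact: hm.
Qed.
End Order.

(** By Levi's lemma the parts before the two occurrences differ by a path [m];
    the three cases are [m] of length 0, 1 and at least 2. *)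
Lemma two_occurrences (Q : quiver) (q t r q' t' r' p : qpath Q) :
  plen t = 2%N -> plen t' = 2%N -> (plen q <= plen q')%N ->
  pmul3 q t r = Some p -> pmul3 q' t' r' = Some p ->
  [\/ [/\ q = q', t = t' & r = r'],
      exists a b c, [/\ pmul (parr a) (parr b) = Some t,
        pmul (parr b) (parr c) = Some t', pmul q (parr a) = Some q'
        & pmul (parr c) r' = Some r]
    | exists m, pmul3 q t m = Some q' /\ pmul3 m t' r' = Some r].
Proof.
move=> t2 t2' le; rewrite /pmul3.
case tr: (pmul t r) => [x|] //= qx; case tr': (pmul t' r') => [x'|] //= qx'.
have [m [qm mx]] := path_levi qx qx' le.
case E: (plen m) => [|[|k]].
- have xx : x' = x by exact: pmul0l mx.
  have qq : q = q' by exact: pmul0r qm.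
  constructor 1; rewrite qq; split=> //.
    have [|m' [tm _]] := path_levi tr (etrans tr' (congr1 Some xx)).
      by rewrite t2 t2'.
    apply: (pmul0r _ tm); apply: (@addnI 2%N).
    by rewrite addn0 -{1}t2 -(plen_pmul tm) t2'.
  have [|m' [tm rm]] := path_levi tr (etrans tr' (congr1 Some xx)).
    by rewrite t2 t2'.
  apply/esym; apply: (pmul0l _ rm); apply: (@addnI 2%N).
  by rewrite addn0 -{1}t2 -(plen_pmul tm) t2'.
- have [a am] := plen1 E.
  have [|y [my yr]] := path_levi mx tr; first by rewrite t2 E.
  have [b yb] : exists b, y = parr b.
    by apply: plen1; have := plen_pmul my; rewrite t2 E add1n; case.
  have [|z [yz zr]] := path_levi yr tr'.
    by rewrite t2' yb.
  have [c zc] : exists c, z = parr c.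
    by apply: plen1; have := plen_pmul yz; rewrite t2' yb add1n; case.
  by constructor 2; exists a, b, c; rewrite -am -yb -zc.
- have [|y [ty yx]] := path_levi tr mx; first by rewrite t2 E.
  by constructor 3; exists y; rewrite /pmul3 ty; split=> //=; rewrite tr'.
Qed.

(** * Leading paths and rewriting rules *)

Section Leading.
Variables (A : comNzRingType) (Q : quiver) (V : pzRingType).
Variables (sc : A -> V -> V) (mono : qpath Q -> V) (coef : V -> qpath Q -> A).
Variables (supp : V -> {fset qpath Q}) (B : path_basis sc mono coef supp).
Variables (gt : rel (qpath Q)) (adm : length_admissible gt).
Variable T : set (qpath Q).
Local Notation "c *: x" := (sc c x) : ring_scope.
Implicit Types (x y : V) (p q r t u : qpath Q) (c : A).

Definition lead x p : Prop :=
  coef x p != 0 /\ forall q, coef x q != 0 -> q != p -> gt p q.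

Definition multiple p : Prop := exists t q r, T t /\ pmul3 q t r = Some p.

Lemma lead_exists x : x != 0 -> exists p, lead x p.
Proof.
move=> nx; have [|m ms hm] := seq_max adm (s := supp x).
  by apply: contraNneq nx => h; rewrite (pb_expand B x) h big_nil.
by exists m; split=> [|q]; rewrite -(pb_supp B) //; exact: hm.
Qed.

(** Multiplication by paths preserves the order, so the non-leading terms of a
    multiple stay below the multiple of the leading path. *)
Lemma mul3_lower x q t r p u :
  (forall s, coef x s != 0 -> s != t -> gt t s) -> pmul3 q t r = Some p ->
  coef (mono q * x * mono r) u != 0 -> u = p \/ gt p u.
Proof.
move=> low e /(coef_mul3 B) [s xs e']; have [st|ne] := eqVneq s t.
  by left; move: e'; rewrite st e => -[].
by right; apply: (gt_mul3 adm e e'); exact: low.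
Qed.

Lemma lead_uniq x p q : lead x p -> lead x q -> p = q.
Proof.
move=> [xp hp] [xq hq]; apply/eqP/negPn/negP => ne.
by apply: (gt_asym adm (hp q xq _) (hq p xp ne)); rewrite eq_sym.
Qed.

Lemma lead_mono p u : lead (mono p) u -> u = p.
Proof.
by case; rewrite (pb_coef_mono B); case: (eqVneq p u) => [//|_]; rewrite eqxx.
Qed.

Section Rule.
Variables (J : finType) (P : pred J) (y : J -> A) (n : J -> qpath Q) (t : qpath Q).
Let rule := mono t - \sum_(j | P j) y j *: mono (n j).

Lemma coef_rule s : coef rule s = (t == s)%:R - \sum_(j | P j && (n j == s)) y j.
Proof.
rewrite (pb_coefB B) (pb_coef_mono B) (pb_coef_sum B) big_mkcondr /=.
congr (_ - _); apply: eq_bigr => j _.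
by rewrite (pb_coefZ B) (pb_coef_mono B); case: eqP => _; rewrite ?mulr1 ?mulr0.
Qed.

Lemma rule_lead : (forall j, P j -> n j != t) -> coef rule t = 1.
Proof.
move=> nt; rewrite coef_rule eqxx big_pred0 ?subr0 // => j.
by apply/negP => /andP[/nt/negPf ->].
Qed.

Lemma rule_supp s : coef rule s != 0 -> s = t \/ exists2 j, P j & n j = s.
Proof.
rewrite coef_rule; have [->|ne] := eqVneq t s; first by left.
have [[j Pj nj]|no] := pselect (exists2 j, P j & n j = s); first by right; exists j.
rewrite big_pred0 ?subr0 ?eqxx // => j; apply/negP => /andP[Pj /eqP nj].
by apply: no; exists j.
Qed.

Lemma rule0 : (forall j, y j = 0) -> rule = mono t.
Proof.
by move=> y0; rewrite /rule big1 ?subr0 // => j _; rewrite y0 (pscale0r B).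
Qed.

Lemma reduction_supp x c q r p s :
  coef (x - c *: mono p +
    c *: \sum_(j | P j) y j *: (mono q * mono (n j) * mono r)) s != 0 ->
  [\/ coef x s != 0, s = p | exists2 j, P j & pmul3 q (n j) r = Some s].
Proof.
have [xs|xs] := boolP (coef x s != 0); first by constructor 1.
have [->|ne] := eqVneq s p; first by constructor 2.
move: xs; rewrite negbK => /eqP xs.
rewrite (pb_coefD B) (pb_coefB B) !(pb_coefZ B) xs (pb_coef_mono B) (eq_sym p) (negPf ne).
rewrite mulr0 subr0 add0r (pb_coef_sum B) => h; constructor 3; apply: contrapT => no.
move/negP: h; apply; apply/eqP; rewrite big1 ?mulr0 // => j Pj.
rewrite (pb_coefZ B); case: (mono_mul3_case B q (n j) r) => [->|[u uE]].
  by rewrite (pb_coef0 B) mulr0.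
rewrite uE (pb_coef_mono B); have [us|] := eqVneq u s; last by rewrite mulr0.
by case: no; exists j => //; apply/(pmul3P B); rewrite uE us.
Qed.
End Rule.

(** * The diamond lemma *)

Section Span.
Variable g : qpath Q -> V.
Hypothesis g_lead : forall t, T t -> coef (g t) t = 1.
Hypothesis g_lower : forall t s, T t -> coef (g t) s != 0 -> s != t -> gt t s.

(** Combinations of the multiples [q g_t r] whose leading path [q t r] lies in
    [S]. The leading paths, and not the supports, are restricted: this is the
    filtration along which the confluence argument runs. *)
Inductive rule_span (S : set (qpath Q)) : V -> Prop :=
| span0 : rule_span S 0
| spanD c q t r p x : T t -> pmul3 q t r = Some p -> S p -> rule_span S x ->
    rule_span S (c *: (mono q * g t * mono r) + x).

Lemma span_add S x y : rule_span S x -> rule_span S y -> rule_span S (x + y).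
Proof.
move=> Sx Sy; elim: Sx => [|c q t r p z Tt e Sp _ IH]; first by rewrite add0r.
by rewrite -addrA; exact: spanD Tt e Sp IH.
Qed.

Lemma span_scale S c x : rule_span S x -> rule_span S (c *: x).
Proof.
elim=> [|d q t r p z Tt e Sp _ IH]; first by rewrite (pscaler0 B); exact: span0.
by rewrite (pscaleDr B) (pscaleA B); exact: spanD Tt e Sp IH.
Qed.

Lemma span_opp S x : rule_span S x -> rule_span S (- x).
Proof. by rewrite -(pscaleN1r B); exact: span_scale. Qed.

Lemma span_sub S x y : rule_span S x -> rule_span S y -> rule_span S (x - y).
Proof. by move=> Sx Sy; apply: span_add => //; exact: span_opp. Qed.

Lemma span1 S c q t r p : T t -> pmul3 q t r = Some p -> S p ->
  rule_span S (c *: (mono q * g t * mono r)).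
Proof. by move=> Tt e Sp; rewrite -[_ *: _]addr0; exact: spanD Tt e Sp (span0 _). Qed.

Lemma span_sub_set (S S' : set (qpath Q)) x : S `<=` S' -> rule_span S x -> rule_span S' x.
Proof.
move=> SS; elim=> [|c q t r p z Tt e Sp _ IH]; first exact: span0.
exact: spanD Tt e (SS _ Sp) IH.
Qed.

Hypothesis g_parallel : forall t s, T t -> coef (g t) s != 0 ->
  [/\ pstart s = pstart t, pend s = pend t & plen s = plen t].

Lemma span_mul (S S' : set (qpath Q)) a b x :
  (forall p u, S p -> pmul3 a p b = Some u -> S' u) ->
  rule_span S x -> rule_span S' (mono a * x * mono b).
Proof.
move=> SS; elim=> [|c q t r p z Tt e Sp _ IH].
  by rewrite mulr0 mul0r; exact: span0.
rewrite mulrDr mulrDl; apply: span_add => //.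
rewrite -(pb_scaleAr B) -(pb_scaleAl B); apply: span_scale.
have -> : mono a * (mono q * g t * mono r) * mono b =
    (mono a * mono q) * g t * (mono r * mono b) by rewrite !mulrA.
have e3 := proj1 (pmul3P B q t r p) e.
rewrite !(pb_mul B); case aq: (pmul a q) => [q'|] /=; last by rewrite !mul0r; exact: span0.
case rb: (pmul r b) => [r'|] /=; last by rewrite mulr0; exact: span0.
have [u e4] : exists u, pmul3 q' t r' = Some u.
  have [h1 h2 _ _ _] := pmul3E e.
  have [_ _ aq' _] := pmulE aq; have [_ rb' _ _] := pmulE rb.
  by apply: pmul3_ex; rewrite ?aq' ?rb'.
rewrite -[_ * _](pscale1r B); apply: (span1 1 Tt e4); apply: SS Sp _.
apply/(pmul3P B); rewrite -e3; move/(pmul3P B): e4 => <-.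
by rewrite !mulrA ((mono_mulP B _ _ _).1 aq) -!mulrA ((mono_mulP B _ _ _).1 rb).
Qed.

Lemma span_bound S x u : rule_span S x -> coef x u != 0 ->
  exists2 p, S p & u = p \/ gt p u.
Proof.
elim=> [|c q t r p z Tt e Sp _ IH]; first by rewrite (pb_coef0 B) eqxx.
rewrite (pb_coefD B) (pb_coefZ B) => h.
have [/eqP h1|h1] := boolP (coef (mono q * g t * mono r) u == 0).
  by apply: IH; move: h; rewrite h1 mulr0 add0r.
by exists p => //; apply: mul3_lower e h1 => s; exact: g_lower.
Qed.

Definition below (S : set (qpath Q)) p : set (qpath Q) := [set u | S u /\ gt p u].
Definition upto (S : set (qpath Q)) p : set (qpath Q) :=
  [set u | S u /\ (u = p \/ gt p u)].

(** Local confluence: two multiples with the same leading path differ by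
    multiples with smaller leading paths. *)
Definition confluent (S : set (qpath Q)) : Prop :=
  forall p q t r q' t' r', S p -> T t -> T t' ->
    pmul3 q t r = Some p -> pmul3 q' t' r' = Some p ->
    rule_span (below S p) (mono q * g t * mono r - mono q' * g t' * mono r').

Lemma span_upto S x : rule_span S x -> x = 0 \/ exists2 p, S p & rule_span (upto S p) x.
Proof.
elim=> [|c q t r p z Tt e Sp _ IH]; first by left.
right; case: IH => [->|[p0 Sp0 sz]].
  by rewrite addr0; exists p => //; apply: span1 Tt e _; split=> //; left.
have [pp|ne] := eqVneq p p0.
  by exists p => //; rewrite -pp in sz; apply: spanD Tt e _ sz; split=> //; left.
have [pp|pp] := orP (la_total adm ne).
  exists p => //; apply: spanD Tt e _ _; first by split=> //; left.
  apply: span_sub_set sz => u [Su [->|h]]; split=> //; right=> //.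
  exact: (gt_trans adm pp h).
by exists p0 => //; apply: spanD Tt e _ sz; split=> //; right.
Qed.

(** Modulo smaller leading paths, confluence merges all multiples with leading
    path [p] into a single one. *)
Lemma span_top S p x : confluent S -> S p -> rule_span (upto S p) x ->
  rule_span (below S p) x \/ exists c q t r y, [/\ T t, pmul3 q t r = Some p,
    x = c *: (mono q * g t * mono r) + y & rule_span (below S p) y].
Proof.
move=> conf Sp; elim=> [|c q t r p' z Tt e [Sp' pp'] _ IH].
  by left; exact: span0.
case: pp' => [pp'|lt].
  right; rewrite pp' in e; case: IH => [sz|[c' [q' [t' [r' [y [Tt' e' -> sy]]]]]]].
    by exists c, q, t, r, z.
  exists (c + c'), q', t', r',
    (c *: (mono q * g t * mono r - mono q' * g t' * mono r') + y).
  split=> //.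
    have regroup (a b d w : V) : a + (b + w) = (d + b) + ((a - d) + w).
      by rewrite addrCA -[RHS]addrA [RHS]addrCA (addrA d) (addrC d) subrK.
    by rewrite (pscaleDl B) (pscaleDr B) (pscalerN B); exact: regroup.
  by apply: span_add => //; apply: span_scale; apply: conf.
case: IH => [sz|[c' [q' [t' [r' [y [Tt' e' -> sy]]]]]]].
  by left; apply: spanD Tt e _ sz.
right; exists c', q', t', r', (c *: (mono q * g t * mono r) + y); split=> //.
  by rewrite addrCA.
by apply: spanD Tt e _ sy.
Qed.

(** If the multiples of the [g_t] are confluent on [S], cancellation of leading
    terms never produces a new leading path: among the representations of an
    element take one whose largest leading path [p] is minimal; then the
    coefficients at [p] cannot cancel, since otherwise confluence would
    rewrite the element below [p]. *)
Lemma span_lead S x u : confluent S -> rule_span S x -> lead x u -> multiple u.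
Proof.
move=> conf sx lx.
have [x0|[p Sp sp]] := span_upto sx.
  by case: lx; rewrite x0 (pb_coef0 B) eqxx.
move: p x u Sp sp lx {sx}; apply: (gt_ind adm) => p IH x u Sp sp lx.
have down y : rule_span (below S p) y -> lead y u -> multiple u.
  move=> sy ly; have [y0|[p' [Sp' lt] sp']] := span_upto sy.
    by case: ly; rewrite y0 (pb_coef0 B) eqxx.
  apply: (IH p' lt y u Sp' _ ly); apply: span_sub_set sp' => v [[Sv _] h].
  by split.
case: (span_top conf Sp sp) => [sx|[c [q [t [r [y [Tt e xE sy]]]]]]].
  exact: down sx lx.
have [c0|nc] := eqVneq c 0.
  by apply: down sy _; move: lx; rewrite xE c0 (pscale0r B) add0r.
have yp v : coef y v != 0 -> gt p v.
  by move=> /(span_bound sy)[w [_ pw]] [-> //|]; apply: (gt_trans adm pw).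
have xp : coef x p = c.
  rewrite xE (pb_coefD B) (pb_coefZ B) (coef_mul3_eq B _ e) g_lead // mulr1.
  have [->|/yp] := eqVneq (coef y p) 0; first by rewrite addr0.
  by rewrite (la_irr adm).
suff -> : u = p by exists t, q, r.
apply/eqP/negPn/negP => ne; case: lx => xu /(_ p).
rewrite xp => /(_ nc); rewrite eq_sym => /(_ ne) up.
have : u = p \/ gt p u.
  have [/eqP h|/yp] := boolP (coef y u == 0); last by right.
  apply: (@mul3_lower (g t) q t r p u _ e) => [s|]; first exact: g_lower.
  move: xu; rewrite xE (pb_coefD B) (pb_coefZ B) h addr0.
  by apply: contraNneq => ->; rewrite mulr0.
by case=> [/eqP|/(gt_asym adm up) //]; rewrite (negPf ne).
Qed.

Lemma span_ideal (I : set V) S x : two_sided_ideal I ->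
  (forall t, T t -> I (g t)) -> rule_span S x -> I x.
Proof.
move=> idI gI; have [I0 ID Il Ir] := idI.
elim=> // c q t r p y Tt _ _ _ Iy; apply: ID => //.
by apply: (ideal_scale B) => //; apply/Ir/Il/gI.
Qed.

Lemma ideal_gen_span x : ideal_gen [set g t | t in T] x -> rule_span setT x.
Proof.
apply.
  apply: (two_sided_ideal_mono B).
  - exact: span0.
  - exact: span_add.
  - by move=> c y; exact: span_scale.
  - move=> a y; elim=> [|c q t r p z Tt e _ _ IH].
      by rewrite mulr0; exact: span0.
    rewrite mulrDr; apply: span_add => //.
    rewrite -(pb_scaleAr B) !mulrA (pb_mul B).
    have [qt tr _ _ _] := pmul3E e.
    case aq: (pmul a q) => [q'|] /=; last first.
      by rewrite !mul0r (pscaler0 B); exact: span0.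
    have [u e'] : exists u, pmul3 q' t r = Some u.
      by apply: pmul3_ex => //; have [_ _ -> _] := pmulE aq.
    exact: (span1 _ Tt e').
  move=> b y; elim=> [|c q t r p z Tt e _ _ IH].
    by rewrite mul0r; exact: span0.
  rewrite mulrDl; apply: span_add => //.
  rewrite -(pb_scaleAl B) -!mulrA (pb_mul B) !mulrA.
  have [qt tr _ _ _] := pmul3E e.
  case rb: (pmul r b) => [r'|] /=; last first.
    by rewrite !mulr0 (pscaler0 B); exact: span0.
  have [u e'] : exists u, pmul3 q t r' = Some u.
    by apply: pmul3_ex => //; have [_ -> _ _] := pmulE rb.
  exact: (span1 _ Tt e').
move=> _ [t Tt <-].
have e : pmul3 (pvert (pstart t)) t (pvert (pend t)) = Some t.
  by apply/(pmul3P B); exact: mono_verts B t.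
suff -> : g t = 1 *: (mono (pvert (pstart t)) * g t * mono (pvert (pend t))).
  exact: (span1 _ Tt e).
rewrite (pscale1r B); apply: (parallel_uniform B) => p.
by move=> /(g_parallel Tt) [].
Qed.

(** In [g_t c - a g_t'] the path [abc] cancels, and what is left is smaller and
    of the same length. *)
Lemma overlap_lower t t' (a b c : arrow Q) w s : T t -> T t' ->
  pmul (parr a) (parr b) = Some t -> pmul (parr b) (parr c) = Some t' ->
  pmul t (parr c) = Some w ->
  coef (g t * mono (parr c) - mono (parr a) * g t') s != 0 ->
  gt w s /\ plen s = plen w.
Proof.
move=> Tt Tt' ab bc tc.
have at' : pmul (parr a) t' = Some w.
  by have := pmulA (parr a) (parr b) (parr c); rewrite ab bc /= tc.
have [->|ne] := eqVneq s w.
  rewrite (pb_coefB B) (coef_mulr_eq B _ tc) (coef_mull_eq B _ at') !g_lead //.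
  by rewrite subrr eqxx.
rewrite (pb_coefB B) => h.
have [/eqP e0|] := boolP (coef (g t * mono (parr c)) s == 0).
  have /(coef_mull B) [n gn an] : coef (mono (parr a) * g t') s != 0.
    by apply: contraNneq h => h0; rewrite e0 h0 subr0.
  have [_ _ nl] := g_parallel Tt' gn.
  split; last by rewrite (plen_pmul an) nl (plen_pmul at').
  apply: (la_mull adm at' an); apply: g_lower => //.
  by apply: contraNneq ne => nt; move: an; rewrite nt at' => -[->].
move=> /(coef_mulr B) [n gn nc]; have [_ _ nl] := g_parallel Tt gn.
split; last by rewrite (plen_pmul nc) nl (plen_pmul tc).
apply: (la_mulr adm tc nc); apply: g_lower => //.
by apply: contraNneq ne => nt; move: nc; rewrite nt tc => -[->].
Qed.

Definition of_length d : set (qpath Q) := [set p | plen p = d].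

(** The generating multiples are homogeneous, so a homogeneous element of the
    span is already a combination of those of its own length. *)
Lemma span_of_length d x : rule_span setT x -> (forall p, coef x p != 0 -> plen p = d) ->
  rule_span (of_length d) x.
Proof.
move=> sx hd; pose C : pred (qpath Q) := [pred p | plen p == d].
have -> : x = component sc mono coef supp C x.
  apply: (pb_coef_inj B) => p; rewrite (coef_component B) /C /=.
  by have [->|/hd ->] := eqVneq (coef x p) 0; rewrite ?if_same ?eqxx.
elim: sx {hd} => [|c q t r p y Tt e _ _ IH].
  by rewrite (component0 B); exact: span0.
rewrite (componentD B) (componentZ B); apply: span_add => //.
set R := mono q * g t * mono r.
suff -> : component sc mono coef supp C R = if plen p == d then R else 0.
  case: eqP => [pd|_]; last by rewrite (pscaler0 B); exact: span0.
  exact: (span1 _ Tt e).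
apply: (pb_coef_inj B) => u; rewrite (coef_component B) /C /=.
have [Ru|] := eqVneq (coef R u) 0.
  by case: ifP => _; case: ifP => _; rewrite ?Ru ?(pb_coef0 B).
move=> /(coef_mul3 B) [s /(g_parallel Tt) [_ _ hs] /pmul3E [_ _ _ _ ->]].
have [_ _ _ _ ->] := pmul3E e; rewrite hs.
by case: ifP => _ //; rewrite (pb_coef0 B).
Qed.

(** A path of length 2 has only one occurrence of a path of length 2, so the
    quadratic part of the ideal needs no confluence hypothesis. *)
Lemma confluent_quadratic : (forall t, T t -> plen t = 2%N) -> confluent (of_length 2).
Proof.
move=> T2 p q t r q' t' r' p2 Tt Tt' e e'.
have [_ _ _ _ pl] := pmul3E e; have [_ _ _ _ pl'] := pmul3E e'.
have q0 : plen q = 0%N by move: pl; rewrite p2 (T2 t) //; lia.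
have q0' : plen q' = 0%N by move: pl'; rewrite p2 (T2 t') //; lia.
have le : (plen q <= plen q')%N by rewrite q0.
case: (two_occurrences (T2 t Tt) (T2 t' Tt') le e e').
- by move=> [-> -> ->]; rewrite subrr; exact: span0.
- move=> [a [b [c [_ _ /plen_pmul h _]]]]; move: h.
  by rewrite q0' q0.
by move=> [m [/pmul3E [_ _ _ _ h] _]]; move: h; rewrite q0' q0 (T2 t).
Qed.

(** Bergman's diamond lemma in the quadratic case: two multiples with the same
    leading path coincide, overlap in one arrow, which is the hypothesis, or
    sit in disjoint places, and then
    [q g_t m t' r - q t m g_t' r = q g_t m (t' - g_t') r - q (t - g_t) m g_t' r]
    has lower leading paths. *)
Lemma confluent_overlaps : (forall t, T t -> plen t = 2%N) ->
  (forall t t' (a b c : arrow Q) w, T t -> T t' -> pmul (parr a) (parr b) = Some t ->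
     pmul (parr b) (parr c) = Some t' -> pmul t (parr c) = Some w ->
     rule_span (below setT w) (g t * mono (parr c) - mono (parr a) * g t')) ->
  confluent setT.
Proof.
move=> T2 ov.
suff le_case p q t r q' t' r' : (plen q <= plen q')%N -> T t -> T t' ->
    pmul3 q t r = Some p -> pmul3 q' t' r' = Some p ->
    rule_span (below setT p) (mono q * g t * mono r - mono q' * g t' * mono r').
  move=> p q t r q' t' r' _ Tt Tt' e e'; have [le|lt] := leqP (plen q) (plen q').
    exact: le_case.
  by rewrite -opprB; apply/span_opp/le_case => //; exact: ltnW.
move=> le Tt Tt' e e'.
case: (two_occurrences (T2 t Tt) (T2 t' Tt') le e e').
- by move=> [-> -> ->]; rewrite subrr; exact: span0.
- move=> [a [b [c [ab bc qa cr]]]].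
  have [w tw] : exists w, pmul t (parr c) = Some w.
    by apply: pmul_ex; have [_ _ -> _] := pmulE ab; have [-> _ _ _] := pmulE bc.
  rewrite -((mono_mulP B _ _ _).1 cr) -((mono_mulP B _ _ _).1 qa).
  have -> : mono q * g t * (mono (parr c) * mono r') -
      mono q * mono (parr a) * g t' * mono r' =
      mono q * (g t * mono (parr c) - mono (parr a) * g t') * mono r'.
    by rewrite mulrBr mulrBl !mulrA.
  apply: span_mul (ov t t' a b c w Tt Tt' ab bc tw) => v u [_ wv] qvr; split=> //.
  apply: (gt_mul3 adm _ qvr wv); apply/(pmul3P B).
  rewrite -((mono_mulP B _ _ _).1 tw) -((pmul3P B _ _ _ _).1 e).
  by rewrite -((mono_mulP B _ _ _).1 cr) !mulrA.
move=> [m [eq' er]].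
have q'E := (pmul3P B _ _ _ _).1 eq'; have rE := (pmul3P B _ _ _ _).1 er.
have [qt tm _ _ _] := pmul3E eq'; have [mt' t'r' rm _ _] := pmul3E er.
have -> : mono q * g t * mono r - mono q' * g t' * mono r' =
    mono q * g t * (mono m * (mono t' - g t') * mono r') -
    (mono q * (mono t - g t) * mono m) * g t' * mono r'.
  by rewrite -q'E -rE !(mulrBr, mulrBl) !mulrA opprB addrA subrK.
have tail_lower t0 s : T t0 -> coef (mono t0 - g t0) s != 0 -> gt t0 s.
  move=> Tt0; rewrite (pb_coefB B) (pb_coef_mono B).
  have [<-|ne] := eqVneq t0 s; first by rewrite g_lead // subrr eqxx.
  by rewrite sub0r oppr_eq0 => h; apply: g_lower => //; rewrite eq_sym.
have left_span y : (forall s, coef y s != 0 -> gt t' s) ->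
    rule_span (below setT p) (mono q * g t * (mono m * y * mono r')).
  move=> ly; apply: (path_basis_ind B (E := [set y |
    rule_span (below setT p) (mono q * g t * (mono m * y * mono r'))])) => /=.
  - by rewrite mulr0 mul0r mulr0; exact: span0.
  - by move=> x z sx sz; rewrite mulrDr mulrDl mulrDr; exact: span_add.
  move=> c s /ly ts; rewrite -(pb_scaleAr B) -(pb_scaleAl B) -(pb_scaleAr B).
  apply: span_scale; case: (mono_mul3_case B m s r') => [->|[v vE]].
    by rewrite mulr0; exact: span0.
  have [_ _ vs _ _] := pmul3E ((pmul3P B _ _ _ _).2 vE).
  have [u e3] : exists u, pmul3 q t v = Some u by apply: pmul3_ex; rewrite ?vs.
  rewrite vE -[_ * _](pscale1r B); apply: (span1 1 Tt e3); split=> //.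
  apply: (gt_mul3 adm e' _ ts); apply/(pmul3P B).
  by rewrite -((pmul3P B _ _ _ _).1 e3) -vE -q'E !mulrA.
have right_span y : (forall s, coef y s != 0 -> gt t s) ->
    rule_span (below setT p) (mono q * y * mono m * g t' * mono r').
  move=> ly; apply: (path_basis_ind B (E := [set y |
    rule_span (below setT p) (mono q * y * mono m * g t' * mono r')])) => /=.
  - by rewrite mulr0 !mul0r; exact: span0.
  - by move=> x z sx sz; rewrite mulrDr !mulrDl; exact: span_add.
  move=> c s /ly ts; rewrite -(pb_scaleAr B) -!(pb_scaleAl B).
  apply: span_scale; case: (mono_mul3_case B q s m) => [->|[v vE]].
    by rewrite !mul0r; exact: span0.
  have [_ _ _ ve _] := pmul3E ((pmul3P B _ _ _ _).2 vE).
  have [u e3] : exists u, pmul3 v t' r' = Some u by apply: pmul3_ex; rewrite ?ve.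
  rewrite vE -[_ * _](pscale1r B); apply: (span1 1 Tt' e3); split=> //.
  apply: (gt_mul3 adm e _ ts); apply/(pmul3P B).
  by rewrite -((pmul3P B _ _ _ _).1 e3) -vE -rE !mulrA.
by apply: span_sub; [apply: left_span|apply: right_span] => s; exact: tail_lower.
Qed.

End Span.
End Leading.
(** * Division *)

Section NormalForms.
Variables (K : fieldType) (Q : quiver) (V : pzRingType).
Variables (sc : K -> V -> V) (mono : qpath Q -> V) (coef : V -> qpath Q -> K).
Variables (supp : V -> {fset qpath Q}) (B : path_basis sc mono coef supp).
Variables (gt : rel (qpath Q)) (adm : length_admissible gt).
Variable T : set (qpath Q).
Local Notation "c *: x" := (sc c x) : ring_scope.
Implicit Types (x y : V) (p q r t u : qpath Q) (c : K).

(** Division with remainder, by induction along the well-order: modulo [J] an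
    occurrence of [t] in a path is traded for smaller paths. The bound on the
    remainder is what makes its paths usable in a rule for [t]. *)
Lemma division (J : set V) x : two_sided_ideal J ->
  (forall t, T t -> exists2 h, J h & lead coef gt h t) ->
  exists2 n, J (x - n) & forall u, coef n u != 0 ->
    ~ multiple T u /\ exists2 p, coef x p != 0 & u = p \/ gt p u.
Proof.
move=> idJ lT; have [J0 JD Jl Jr] := idJ.
have linear (S : set (qpath Q)) y :
    (forall p, coef y p != 0 -> exists2 n, J (mono p - n) &
       forall u, coef n u != 0 -> ~ multiple T u /\ S u) ->
    exists2 n, J (y - n) & forall u, coef n u != 0 -> ~ multiple T u /\ S u.
  move=> hy; apply: (path_basis_ind B (E := [set y | exists2 n, J (y - n) &
       forall u, coef n u != 0 -> ~ multiple T u /\ S u])) => /=.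
  - by exists 0; [rewrite subr0|move=> u; rewrite (pb_coef0 B) eqxx].
  - move=> y1 y2 [n1 J1 h1] [n2 J2 h2]; exists (n1 + n2).
      by rewrite opprD addrACA; exact: JD.
    move=> u; rewrite (pb_coefD B) => h.
    have [/eqP e|] := boolP (coef n1 u == 0); last exact: h1.
    by apply: h2; move: h; rewrite e add0r.
  move=> c p /hy [n Jn hn]; exists (c *: n).
    by rewrite -(pscalerN B) -(pscaleDr B); exact: (ideal_scale B).
  move=> u; rewrite (pb_coefZ B) => h; apply: hn.
  by apply: contraNneq h => ->; rewrite mulr0.
have path p : exists2 n, J (mono p - n) & forall u, coef n u != 0 ->
    ~ multiple T u /\ (u = p \/ gt p u).
  move: p; apply: (gt_ind adm) => p IH.
  have [[t [q [r [Tt e]]]]|np] := pselect (multiple T p); last first.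
    exists (mono p); first by rewrite subrr.
    move=> u; rewrite (pb_coef_mono B); case: (eqVneq p u) => [<- _|_].
      by split=> //; left.
    by rewrite eqxx.
  have [h Jh [ht low]] := lT t Tt.
  pose y := mono q * h * mono r; pose a := coef h t.
  have yp : coef y p = a by exact: (coef_mul3_eq B).
  have Jy : J y by apply: Jr; apply: Jl.
  have zlow u : coef (mono p - a^-1 *: y) u != 0 -> gt p u.
    have [->|ne] := eqVneq u p.
      by rewrite (pb_coefB B) (pb_coefZ B) yp (pb_coef_mono B) eqxx mulVf // subrr eqxx.
    rewrite (pb_coefB B) (pb_coef_mono B) (eq_sym p) (negPf ne) sub0r (pb_coefZ B) oppr_eq0 => nz.
    have /(mul3_lower B adm low e) [] // : coef y u != 0.
      by apply: contraNneq nz => ->; rewrite mulr0.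
    by move/eqP; rewrite (negPf ne).
  have [n Jn hn] : exists2 n, J (mono p - a^-1 *: y - n) & forall u, coef n u != 0 ->
      ~ multiple T u /\ (u = p \/ gt p u).
    apply: (linear [set u | u = p \/ gt p u]) => s /zlow ps.
    have [n Jn hn] := IH s ps; exists n => // u /hn [nu us]; split=> //; right.
    by case: us => [->//|]; exact: (gt_trans adm ps).
  exists n => //; rewrite -[mono p](subrK (a^-1 *: y)) addrAC.
  by apply: JD => //; exact: (ideal_scale B).
apply: (linear [set u | exists2 p, coef x p != 0 & u = p \/ gt p u]) => p xp.
by have [n Jn hn] := path p; exists n => // u /hn [nu up]; split=> //; exists p.
Qed.

(** The remainder of an element of [I] modulo [J] is in [I] and has no path with
    a subpath in [T], so it has no leading path at all. *)
Lemma division_ideal (I J : set V) : two_sided_ideal I -> two_sided_ideal J ->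
  J `<=` I -> (forall x u, I x -> lead coef gt x u -> multiple T u) ->
  (forall t, T t -> exists2 h, J h & lead coef gt h t) -> I = J.
Proof.
move=> idI idJ JI lI lJ; apply/seteqP; split=> // x Ix.
have [n Jn hn] := division x idJ lJ.
suff n0 : n = 0 by move: Jn; rewrite n0 subr0.
apply/eqP/negPn/negP => /(lead_exists B adm) [u lu].
have In : I n by rewrite -[n](subKr x); apply: (ideal_sub B idI) => //; exact: JI.
by have [nu _] := hn u lu.1; apply: nu; exact: lI In lu.
Qed.

(** In a homogeneous ideal the rewriting rule of [t] can be chosen parallel to
    [t], by passing to the block of [t]. *)
Lemma parallel_rule (X : set V) t :
  (forall y, X y -> exists d, forall p, coef y p != 0 -> plen p = d) ->
  (forall t, T t -> exists2 h, ideal_gen X h & lead coef gt h t) -> T t ->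
  exists2 n, ideal_gen X (mono t - n) & forall u, coef n u != 0 ->
    [/\ ~ multiple T u, gt t u, pstart u = pstart t, pend u = pend t
      & plen u = plen t].
Proof.
move=> homX lT Tt; have idI := ideal_gen_ideal X.
have [n In hn] := division (mono t) idI lT.
pose C := block (plen t) (pstart t) (pend t).
exists (component sc mono coef supp C n).
  have -> : mono t - component sc mono coef supp C n =
      component sc mono coef supp C (mono t - n).
    apply: (pb_coef_inj B) => p; rewrite (pb_coefB B) !(coef_component B).
    rewrite (pb_coefB B) (pb_coef_mono B).
    by have [<-|_] := eqVneq t p; case: ifP; rewrite ?subr0 // /C /block /= !eqxx.
  exact: (ideal_gen_block B).
move=> u; rewrite (coef_component B) /C /block /=.
case: and3P => [[/eqP ul /eqP us /eqP ue]|_]; last by rewrite eqxx.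
move=> /hn [nu [p]]; rewrite (pb_coef_mono B).
case: (eqVneq t p) => [<- _|_]; last by rewrite eqxx.
case=> [ut|tu]; last by split.
case: nu; exists t, (pvert (pstart t)), (pvert (pend t)); split=> //.
by rewrite ut; apply/(pmul3P B); exact: mono_verts B t.
Qed.

End NormalForms.

(** * Change of coefficients *)

Section Evaluation.
Variables (A1 A2 : comNzRingType) (f : {rmorphism A1 -> A2}) (Q : quiver).
Variables (V1 V2 : pzRingType).
Variables (sc1 : A1 -> V1 -> V1) (mono1 : qpath Q -> V1) (coef1 : V1 -> qpath Q -> A1).
Variables (supp1 : V1 -> {fset qpath Q}) (B1 : path_basis sc1 mono1 coef1 supp1).
Variables (sc2 : A2 -> V2 -> V2) (mono2 : qpath Q -> V2) (coef2 : V2 -> qpath Q -> A2).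
Variables (supp2 : V2 -> {fset qpath Q}) (B2 : path_basis sc2 mono2 coef2 supp2).
Implicit Types (x y : V1) (p q r t : qpath Q).

Definition eval_coef x : V2 := \sum_(p <- supp1 x) sc2 (f (coef1 x p)) (mono2 p).

Lemma coef_eval x p : coef2 (eval_coef x) p = f (coef1 x p).
Proof.
rewrite (coef_comb B2); case: ifP => //; rewrite (pb_supp B1) => /negbFE/eqP ->.
by rewrite rmorph0.
Qed.

Lemma eval_coefD x y : eval_coef (x + y) = eval_coef x + eval_coef y.
Proof.
by apply: (pb_coef_inj B2) => p; rewrite (pb_coefD B2) !coef_eval (pb_coefD B1) rmorphD.
Qed.

Lemma eval_coef0 : eval_coef 0 = 0.
Proof.
by apply: (pb_coef_inj B2) => p; rewrite coef_eval (pb_coef0 B1) (pb_coef0 B2) rmorph0.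
Qed.

Lemma eval_coefB x y : eval_coef (x - y) = eval_coef x - eval_coef y.
Proof.
by apply: (pb_coef_inj B2) => p; rewrite (pb_coefB B2) !coef_eval (pb_coefB B1) rmorphB.
Qed.

Lemma eval_coefZ c x : eval_coef (sc1 c x) = sc2 (f c) (eval_coef x).
Proof.
by apply: (pb_coef_inj B2) => p; rewrite (pb_coefZ B2) !coef_eval (pb_coefZ B1) rmorphM.
Qed.

Lemma eval_coef_mono p : eval_coef (mono1 p) = mono2 p.
Proof.
apply: (pb_coef_inj B2) => q; rewrite coef_eval (pb_coef_mono B1) (pb_coef_mono B2).
by rewrite rmorph_nat.
Qed.

Lemma eval_coef_sum (J : Type) (s : seq J) (P : pred J) (F : J -> V1) :
  eval_coef (\sum_(j <- s | P j) F j) = \sum_(j <- s | P j) eval_coef (F j).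
Proof. exact: (big_morph _ eval_coefD eval_coef0). Qed.

Lemma eval_coefM x y : eval_coef (x * y) = eval_coef x * eval_coef y.
Proof.
apply: (path_basis_ind B1 (E := [set x |
    eval_coef (x * y) = eval_coef x * eval_coef y])) => /=.
- by rewrite mul0r eval_coef0 mul0r.
- by move=> u w hu hw; rewrite mulrDl !eval_coefD hu hw mulrDl.
move=> c p _; rewrite -(pb_scaleAl B1) !eval_coefZ -(pb_scaleAl B2).
congr (sc2 _ _); apply: (path_basis_ind B1 (E := [set y |
    eval_coef (mono1 p * y) = eval_coef (mono1 p) * eval_coef y])) => /=.
- by rewrite mulr0 eval_coef0 mulr0.
- by move=> u w hu hw; rewrite mulrDr !eval_coefD hu hw mulrDr.
move=> d q _; rewrite -(pb_scaleAr B1) !eval_coefZ -(pb_scaleAr B2) !eval_coef_mono.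
congr (sc2 _ _); rewrite (pb_mul B1) (pb_mul B2).
by case: (pmul p q) => [r|] /=; rewrite ?eval_coef_mono ?eval_coef0.
Qed.

Lemma eval_rule (J : finType) (P : pred J) (y : J -> A1) (n : J -> qpath Q) t :
  eval_coef (mono1 t - \sum_(j | P j) sc1 (y j) (mono1 (n j))) =
  mono2 t - \sum_(j | P j) sc2 (f (y j)) (mono2 (n j)).
Proof.
rewrite eval_coefB eval_coef_mono eval_coef_sum.
by under eq_bigr => j _ do rewrite eval_coefZ eval_coef_mono.
Qed.

(** The coefficient [c] may specialize to zero, so a reduction step need not
    specialize to a reduction step; but it always subtracts a multiple of the
    specialized rule. *)
Lemma eval_reduction (J : finType) (P : pred J) (y : J -> A1) (n : J -> qpath Q)
    c x q t r p : pmul3 q t r = Some p ->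
  eval_coef (x - sc1 c (mono1 p) +
    sc1 c (\sum_(j | P j) sc1 (y j) (mono1 q * mono1 (n j) * mono1 r))) =
  eval_coef x - sc2 (f c) (mono2 q *
    (mono2 t - \sum_(j | P j) sc2 (f (y j)) (mono2 (n j))) * mono2 r).
Proof.
move=> e; rewrite eval_coefD eval_coefB !eval_coefZ eval_coef_mono eval_coef_sum.
under eq_bigr => j _ do rewrite eval_coefZ !eval_coefM !eval_coef_mono.
rewrite mulrBr mulrBl ((pmul3P B2 _ _ _ _).1 e).
rewrite (pscaleDr B2) (pscalerN B2) opprB -addrA; congr (_ + _).
rewrite addrC; congr (_ - _); congr (sc2 _ _).
rewrite mulr_sumr mulr_suml; apply: eq_bigr => j _.
by rewrite -(pb_scaleAr B2) -(pb_scaleAl B2).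
Qed.

End Evaluation.
(** * Ideals generated by the rules of a point *)

Section QuadraticRules.
Variables (K : fieldType) (Q : quiver) (gt : rel (qpath Q)).
Variables (adm : length_admissible gt) (T : {fset qpath Q}).
Hypothesis T2 : forall t, t \in T -> plen t = 2%N.
Local Notation TP := (T_paths T).
Local Notation idx := (varidx K gt T).
Local Notation BK := (pathalg_basis K Q).
Local Notation pleads := (lead (@pcoef K Q) gt).
Implicit Types (X : affpoint K gt T) (I : set (pathalg K Q)).

Lemma normal_multiple p : normal K gt T p <-> ~ multiple TP p.
Proof.
rewrite Defs.normalE; split=> [h [t [q [r [Tt e]]]]|h t q r Tt e].
  exact: h t q r Tt e.
by apply: h; exists t, q, r.
Qed.

Lemma varidxP (t n : qpath Q) : ((t, n) \in idx) =
  (t \in T) && [&& plen n == 2%N, n \in normal K gt T, gt t n,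
    pstart n == pstart t & pend n == pend t].
Proof.
apply/imfset2P/idP => /= [[t' Tt' [n' nn' [-> ->]]]|/andP[Tt nn]].
  by rewrite Tt' /=; move: nn'; rewrite !inE mem_paths_of_len.
by exists t => //; exists n => //; rewrite !inE mem_paths_of_len.
Qed.

Lemma varidx_rule (i : idx) : [/\ (val i).1 \in T, gt (val i).1 (val i).2 &
  [/\ pstart (val i).2 = pstart (val i).1, pend (val i).2 = pend (val i).1
    & plen (val i).2 = 2%N]].
Proof.
have := valP i; case: (val i) => t n; rewrite varidxP => /andP[Tt].
by move=> /and5P[/eqP ? _ ? /eqP ? /eqP ?].
Qed.

Section Gelt.
Variables (A : comNzRingType) (x : idx -> A).

Lemma gelt_lead t : TP t -> pcoef (gelt x t) t = 1.
Proof.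
move=> Tt; apply: (rule_lead (pathalg_basis A Q)) => i /eqP it.
have [_ h _] := varidx_rule i.
by apply: contraTneq h => ->; rewrite it (la_irr adm).
Qed.

Lemma gelt_lower t s : TP t -> pcoef (gelt x t) s != 0 -> s != t -> gt t s.
Proof.
move=> Tt /(rule_supp (pathalg_basis A Q)) [->|[i /eqP <- <-] _].
  by rewrite eqxx.
by have [_ h _] := varidx_rule i.
Qed.

Lemma gelt_parallel t s : TP t -> pcoef (gelt x t) s != 0 ->
  [/\ pstart s = pstart t, pend s = pend t & plen s = plen t].
Proof.
move=> Tt /(rule_supp (pathalg_basis A Q)) [->//|[i /eqP it <-]].
have [Ti _ [-> -> ->]] := varidx_rule i; by rewrite (T2 Tt) it.
Qed.
End Gelt.

Lemma is_tipE (x : pathalg K Q) p : is_tip gt x p <-> pleads x p.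
Proof.
split=> [[px hp]|[px hp]]; split.
- by rewrite -(pb_supp BK).
- by move=> q; rewrite -(pb_supp BK); exact: hp.
- by move: px; rewrite -(pb_supp BK).
- by move=> q qx; apply: hp; rewrite -(pb_supp BK).
Qed.

Lemma ideal_gen_sub (R : pzRingType) (S J : set R) :
  two_sided_ideal J -> S `<=` J -> ideal_gen S `<=` J.
Proof. by move=> idJ SJ x; apply. Qed.

Lemma tip_ideal_sub (S : set (pathalg K Q)) :
  (forall x u, S x -> pleads x u -> multiple TP u) ->
  tip_ideal gt S `<=` ideal_gen (T_set K T).
Proof.
move=> h; apply: ideal_gen_sub; first exact: ideal_gen_ideal.
move=> _ [u [x Sx /is_tipE xu] <-].
by have [t [q [r [Tt e]]]] := h x u Sx xu; exact: monomial_multiple BK _ _ _ _ _ Tt e.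
Qed.

Lemma tip_ideal_sup (S : set (pathalg K Q)) :
  (forall t, TP t -> exists2 h, S h & pleads h t) ->
  ideal_gen (T_set K T) `<=` tip_ideal gt S.
Proof.
move=> h; apply: ideal_gen_sub; first exact: ideal_gen_ideal.
move=> _ [t Tt <-]; apply: sub_ideal_gen; exists t => //.
by have [x Sx xt] := h t Tt; exists x => //; apply/is_tipE.
Qed.

Lemma tip_ideal_eq (S : set (pathalg K Q)) :
  (forall x u, S x -> pleads x u -> multiple TP u) ->
  (forall t, TP t -> exists2 h, S h & pleads h t) ->
  tip_ideal gt S = ideal_gen (T_set K T).
Proof.
by move=> h1 h2; apply/seteqP; split; [exact: tip_ideal_sub|exact: tip_ideal_sup].
Qed.

Lemma tip_ideal_multiple (S : set (pathalg K Q)) x u :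
  tip_ideal gt S `<=` ideal_gen (T_set K T) -> S x -> pleads x u -> multiple TP u.
Proof.
move=> tS Sx xu; apply: (ideal_gen_monomial BK (x := pth K u)).
  by apply: tS; apply: sub_ideal_gen; exists u => //; exists x => //; apply/is_tipE.
by rewrite (pb_coef_mono BK) eqxx oner_eq0.
Qed.

Lemma pmul3_same_len (q t r p : qpath Q) :
  pmul3 q t r = Some p -> plen t = plen p -> t = p.
Proof.
move=> e tp; have [_ _ _ _ pl] := pmul3E e.
move: e; rewrite /pmul3; case tr: (pmul t r) => [z|] //= qz.
have -> : t = z by apply: pmul0r tr; lia.
by apply: pmul0l qz; lia.
Qed.

(** A path [t] of [T] lies in the monomial ideal of the tips of [S], so it
    contains a tip; that tip contains in turn a path of [T], hence has length
    at least 2 and is [t]. *)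
Lemma tip_ideal_lead (S : set (pathalg K Q)) t :
  tip_ideal gt S = ideal_gen (T_set K T) -> TP t -> exists2 h, S h & pleads h t.
Proof.
move=> tS Tt.
have : tip_ideal gt S (pth K t).
  by rewrite tS; apply: sub_ideal_gen; exists t.
move=> /(ideal_gen_monomial BK (u := t)) [|u [q [r [[x Sx /is_tipE xu] e]]]].
  by rewrite (pb_coef_mono BK) eqxx oner_eq0.
have [t' [q' [r' [Tt' e']]]] : multiple TP u.
  by apply: tip_ideal_multiple Sx xu; rewrite tS.
suff <- : u = t by exists x.
apply: (pmul3_same_len e); have [_ _ _ _ l] := pmul3E e.
have [_ _ _ _ l'] := pmul3E e'; move: l l'; rewrite (T2 Tt) (T2 Tt').
lia.
Qed.

Lemma gelt_leads X t : TP t -> pleads (gelt X t) t.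
Proof.
move=> Tt; split; first by rewrite gelt_lead // oner_eq0.
by move=> s; exact: gelt_lower.
Qed.

Lemma homogeneousE (x : pathalg K Q) :
  homogeneous x <-> exists d, forall p, pcoef x p != 0 -> plen p = d.
Proof.
split=> -[d hd]; exists d => p; first by rewrite -(pb_supp BK); exact: hd.
by move=> px; apply: hd; rewrite -(pb_supp BK).
Qed.

Lemma gelt_quadratic X t : TP t -> quadratic (gelt X t).
Proof.
move=> Tt p px; have [|_ _ ->] := @gelt_parallel _ X t p Tt; last exact: T2.
by rewrite -(pb_supp BK).
Qed.

Lemma gelt_uniform X t : TP t -> uniform (gelt X t).
Proof.
move=> Tt; split.
  by apply/eqP => g0; have := gelt_lead X Tt; rewrite g0 (pb_coef0 BK) => /esym/eqP; rewrite oner_eq0.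
exists (pstart t), (pend t); apply: (parallel_uniform BK) => p.
by move=> /(gelt_parallel Tt) [].
Qed.

Lemma graded_G_set X : graded_ideal (ideal_gen (G_set X)).
Proof.
exists (G_set X) => // _ [t Tt <-]; exists 2%N; exact: gelt_quadratic.
Qed.

(** The tip of [g_t] is [t], so all that a Groebner basis requires of [G(X)]
    is the tip ideal. *)
Lemma groebner_G_set X :
  mon_ideal gt (ideal_gen (G_set X)) = ideal_gen (T_set K T) ->
  groebner_basis gt (ideal_gen (G_set X)) (G_set X).
Proof.
move=> tI; split; first exact: graded_G_set.
- exact: sub_ideal_gen.
- move=> _ [t Tt <-]; split; last exact: gelt_uniform.
  by exists 2%N; exact: gelt_quadratic.
rewrite -[RHS]/(mon_ideal gt _) tI; apply: tip_ideal_eq.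
  move=> _ u [t Tt <-] gu; have -> : u = t by exact: (lead_uniq adm gu (gelt_leads X Tt)).
  exists t, (pvert (pstart t)), (pvert (pend t)); split=> //.
  by apply/(pmul3P BK); exact: (mono_verts BK).
by move=> t Tt; exists (gelt X t); [exists t|exact: gelt_leads].
Qed.

(** The points of the affine space are recovered from the ideals: if the tips
    of a graded ideal generate the monomial ideal of [T], reducing each [t]
    modulo the ideal produces the rules. *)
Lemma mon_ideal_point I : graded_ideal I -> mon_ideal gt I = ideal_gen (T_set K T) ->
  exists2 X : affpoint K gt T, corresponds I X & groebner_basis gt I (G_set X).
Proof.
move=> [H homH IE] tI.
have lT t : TP t -> exists2 h, ideal_gen H h & pleads h t.
  by rewrite -IE; exact: tip_ideal_lead.
have homH' y : H y -> exists d, forall p, pcoef y p != 0 -> plen p = d.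
  by move=> Hy; apply/homogeneousE/homH.
have /choice [n hn] t : exists n : pathalg K Q, TP t ->
    ideal_gen H (pth K t - n) /\ forall u, pcoef n u != 0 ->
    [/\ ~ multiple TP u, gt t u, pstart u = pstart t, pend u = pend t
      & plen u = plen t].
  have [Tt|nT] := pselect (TP t); last by exists 0.
  by have [n In hn] := parallel_rule BK adm homH' lT Tt; exists n.
(* The coordinates of the point are the coefficients of the remainders. *)
pose X : affpoint K gt T := [ffun i : idx => pcoef (n (val i).1) (val i).2].
have gE t : TP t -> gelt X t = pth K t - n t.
  move=> Tt; apply: (pb_coef_inj BK) => s.
  apply: etrans (coef_rule BK _ _ _ _ _) _.
  rewrite (pb_coefB BK) (pb_coef_mono BK); congr (_ - _).
  have [ts|ts] := boolP ((t, s) \in idx).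
    have Xts : X [` ts]%fset = pcoef (n t) s by rewrite /X ffunE.
    apply: etrans (big_pred1 [` ts]%fset _) Xts => i.
    by rewrite -[RHS](inj_eq val_inj) -xpair_eqE -surjective_pairing.
  rewrite big_pred0; last first.
    move=> i; apply: contraNF ts => /andP[/eqP <- /eqP <-].
    by have := valP i; case: (val i).
  apply/esym/eqP; apply: contraNT ts => /(hn t Tt).2 [nm tgs ps pe pl].
  rewrite varidxP tgs ps pe pl (T2 Tt) !eqxx Tt /= andbT.
  by rewrite in_setE; apply/normal_multiple.
have GI : ideal_gen (G_set X) `<=` I.
  rewrite IE; apply: ideal_gen_sub; first exact: ideal_gen_ideal.
  by move=> _ [t Tt <-]; rewrite gE //; exact: (hn t Tt).1.
(* The rules already have all of [T] as tips, so they generate the ideal. *)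
have IG : I = ideal_gen (G_set X).
  apply: (division_ideal BK adm (T := TP)) => //.
  - by rewrite IE; exact: ideal_gen_ideal.
  - exact: ideal_gen_ideal.
  - by move=> x u; apply: tip_ideal_multiple; rewrite -tI.
  by move=> t Tt; exists (gelt X t); [apply: sub_ideal_gen; exists t|exact: gelt_leads].
exists X => //; rewrite IG; apply: groebner_G_set.
by rewrite -IG.
Qed.

Lemma G_set_quadratic X : G_set X `<=` @quadratic K Q.
Proof. by move=> _ [t Tt <-]; exact: gelt_quadratic. Qed.

Lemma mon_ideal_koszul I : graded_ideal I -> mon_ideal gt I = ideal_gen (T_set K T) ->
  strong_koszul gt I /\ exists2 X : affpoint K gt T, GrAlg X & corresponds I X.
Proof.
move=> gI tI; have [X IX gb] := mon_ideal_point gI tI.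
have sk : strong_koszul gt I by exists (G_set X) => //; exact: G_set_quadratic.
by split=> //; exists X => //; rewrite /GrAlg /= -IX.
Qed.

(** A quadratic element of [<G(X)>] is a combination of the [g_t], so the tips
    of any quadratic Groebner basis are in [T]. *)
Lemma koszul_mon_ideal X : strong_koszul gt (ideal_gen (G_set X)) ->
  mon_ideal gt (ideal_gen (G_set X)) = ideal_gen (T_set K T).
Proof.
move=> [G [_ GI _ tG] qG]; apply/seteqP; split; last first.
  apply: tip_ideal_sup => t Tt; exists (gelt X t); last exact: gelt_leads.
  by apply: sub_ideal_gen; exists t.
rewrite -[mon_ideal _ _]/(tip_ideal _ _) -tG; apply: tip_ideal_sub => x u Gx xu.
have sx := ideal_gen_span BK (@gelt_parallel _ X) (GI _ Gx).
have x2 p : pcoef x p != 0 -> plen p = 2%N.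
  by rewrite -(pb_supp BK); exact: qG.
have sx2 := span_of_length BK (@gelt_parallel _ X) sx x2.
apply: (span_lead BK adm (@gelt_lead _ X) (@gelt_lower _ X) _ sx2 xu).
exact: confluent_quadratic.
Qed.

End QuadraticRules.
(** * The overlap polynomials *)

Section Reductions.
Variables (K : fieldType) (Q : quiver) (gt : rel (qpath Q)).
Variables (adm : length_admissible gt) (T : {fset qpath Q}).
Hypothesis T2 : forall t, t \in T -> plen t = 2%N.
Local Notation TP := (T_paths T).
Local Notation idx := (varidx K gt T).
Local Notation Y := (ypoly K gt T).
Local Notation BK := (pathalg_basis K Q).
Local Notation BY := (pathalg_basis Y Q).
Variable X : affpoint K gt T.

Definition point_eval : {rmorphism Y -> K} :=
  meval (fun j : 'I_#|{: idx}| => X (enum_val j)).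
Local Notation ev := point_eval.
Local Notation phi := (@eval_coef Y K ev Q (pathalg Y Q) (pathalg K Q)
  (@pcoef Y Q) (@psupp Y Q) *:%R (@pth K Q)).

Lemma point_eval_yvar i : ev (yvar i) = X i.
Proof. by apply: etrans (mevalXU _ _) _; rewrite enum_rankK. Qed.

Lemma gelt_eval t :
  pth K t - \sum_(i : idx | (val i).1 == t) ev (yvar i) *: pth K (val i).2 = gelt X t.
Proof.
apply: (congr1 (fun z => pth K t - z)); apply: eq_bigr => i _.
exact: (congr1 (fun c => c *: pth K (val i).2) (point_eval_yvar i)).
Qed.

Lemma eval_helt t : phi (helt K gt T t) = gelt X t.
Proof. by apply: etrans (eval_rule ev BY BK _ _ _ _) _; exact: gelt_eval. Qed.

Local Notation small w := [set s | gt w s /\ plen s = plen w].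
Local Notation sspan w := (@rule_span K Q (pathalg K Q) *:%R (@pth K Q) TP
  (gelt X) (below gt setT w)).

Lemma simple_reduction_eval w F F' :
  simple_reduction F F' -> (forall s, pcoef F s != 0 -> small w s) ->
  (forall s, pcoef F' s != 0 -> small w s) /\ sspan w (phi F - phi F').
Proof.
move=> [p [q [t [r [Fp Tt e ->]]]]] Fw; have [wp lp] := Fw p Fp; split=> [s|].
  case/(reduction_supp BY) => [/Fw //|-> //|[i /eqP it e']].
  have [Ti lt [_ _ l]] := varidx_rule i.
  have [_ _ _ _ l1] := pmul3E e; have [_ _ _ _ l2] := pmul3E e'.
  split; last by rewrite -lp l1 l2 l (T2 Tt).
  by apply: (gt_trans adm wp); apply: (gt_mul3 adm e e'); rewrite -it.
rewrite (eval_reduction ev BY BK _ _ _ _ _ e) opprB addrC subrK.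
rewrite gelt_eval.
by apply: (@span1 K Q (pathalg K Q) _ _ TP (gelt X) _ _ q t r p Tt e); split.
Qed.

Lemma reductions_eval w F F' :
  clos_refl_trans (pathalg Y Q) (@simple_reduction K Q gt T) F F' ->
  (forall s, pcoef F s != 0 -> small w s) ->
  (forall s, pcoef F' s != 0 -> small w s) /\ sspan w (phi F - phi F').
Proof.
elim=> {F F'} [F F' red|F|F F1 F' _ IH1 _ IH2] Fw.
- exact: simple_reduction_eval.
- by split=> //; rewrite subrr; exact: span0.
have [F1w s1] := IH1 Fw; have [F'w s2] := IH2 F1w; split; first exact: F'w.
by have := span_add s1 s2; rewrite subrKA.
Qed.

Lemma irreducible_normal F s : (forall F', ~ @simple_reduction K Q gt T F F') ->
  pcoef F s != 0 -> normal K gt T s.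
Proof.
move=> irr Fs; apply/normal_multiple => -[t [q [r [Tt e]]]].
by apply: irr; exists s, q, t, r; split.
Qed.

Lemma Ov_eval t t' a c :
  phi (Ov K gt T t t' a c) = gelt X t * pth K (parr c) - pth K (parr a) * gelt X t'.
Proof.
apply: etrans (eval_coefB ev BY BK _ _) _; apply: (congr2 (fun x y => x - y)).
  apply: etrans (eval_coefM ev BY BK _ _) _.
  by apply: (congr2 (fun x y => x * y)); [exact: eval_helt|exact: (eval_coef_mono ev BY BK)].
apply: etrans (eval_coefM ev BY BK _ _) _.
by apply: (congr2 (fun x y => x * y)); [exact: (eval_coef_mono ev BY BK)|exact: eval_helt].
Qed.

Lemma overlap_path (t t' : qpath Q) (a b c : arrow Q) : overlap T t t' a b c ->
  exists2 w, pmul t (parr c) = Some w & plen w = 3%N.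
Proof.
move=> [Tt Tt' ab bc]; have [w tw] : exists w, pmul t (parr c) = Some w.
  by apply: pmul_ex; have [_ _ -> _] := pmulE ab; have [-> _ _ _] := pmulE bc.
by exists w => //; rewrite (plen_pmul tw) (T2 Tt).
Qed.

(** Evaluating a complete reduction at [X] leaves, modulo multiples of the
    [g_t] with leading path below the overlapping path [w], a combination of
    normal paths of length 3. *)
Lemma complete_reduction_eval (red : qpath Q -> qpath Q -> pathalg Y Q)
    t t' (a b c : arrow Q) w :
  reduction_choice red -> overlap T t t' a b c -> pmul t (parr c) = Some w ->
  (forall s, pcoef (red t t') s != 0 -> normal K gt T s /\ plen s = plen w) /\
  sspan w (gelt X t * pth K (parr c) - pth K (parr a) * gelt X t' - phi (red t t')).
Proof.
move=> rc ov tw; have [chain irr] := rc t t' a b c ov.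
have [Tt Tt' ab bc] := ov.
have Ovw s : pcoef (Ov K gt T t t' a c) s != 0 -> small w s.
  pose y := @yvar K Q gt T.
  exact: (overlap_lower BY adm (gelt_lead adm y) (gelt_lower (x := y))
    (gelt_parallel T2 (x := y)) Tt Tt' ab bc tw).
have [Fw sF] := reductions_eval chain Ovw.
split; last by rewrite -Ov_eval.
by move=> s rs; split; [exact: irreducible_normal irr rs|have [] := Fw s rs].
Qed.

(** If the overlap polynomials vanish at [X], the complete reductions evaluate
    to zero: all overlaps are resolved and the diamond lemma applies. *)
Lemma zero_set_mon_ideal (red : qpath Q -> qpath Q -> pathalg Y Q) :
  reduction_choice red -> zero_set (I_poly red) X ->
  mon_ideal gt (ideal_gen (G_set X)) = ideal_gen (T_set K T).
Proof.
move=> rc ZX; apply: (tip_ideal_eq (gt := gt)); last first.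
  move=> t Tt; exists (gelt X t); last exact: gelt_leads.
  by apply: sub_ideal_gen; exists t.
move=> x u Ix xu.
have sx := ideal_gen_span BK (gelt_parallel T2 (x := X)) Ix.
apply: (span_lead BK adm (gelt_lead adm X) (gelt_lower (x := X)) _ sx xu).
apply: (confluent_overlaps BK adm (gelt_lead adm X) (gelt_lower (x := X))) => //.
move=> t t' a b c w Tt Tt' ab bc tw.
have ov : overlap T t t' a b c by split.
have [w' tw' w3] := overlap_path ov.
have ww : w = w' by move: tw'; rewrite tw => -[].
have [rn] := complete_reduction_eval rc ov tw.
suff -> : phi (red t t') = 0 by rewrite subr0.
apply: (pb_coef_inj BK) => s; rewrite (coef_eval ev BY BK) (pb_coef0 BK).
have [->|/rn [ns sl]] := eqVneq (pcoef (red t t') s) 0; first exact: rmorph0.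
apply: ZX; exists t, t', a, b, c, s; split=> //.
by rewrite sl ww.
Qed.

(** Conversely the evaluated reduction is an element of the ideal supported on
    normal paths; when no normal path is a tip, it has to vanish. *)
Lemma mon_ideal_zero_set (red : qpath Q -> qpath Q -> pathalg Y Q) :
  reduction_choice red ->
  mon_ideal gt (ideal_gen (G_set X)) = ideal_gen (T_set K T) ->
  zero_set (I_poly red) X.
Proof.
move=> rc tI _ [t [t' [a [b [c [n [ov nn n3 ->]]]]]]].
have [w tw _] := overlap_path ov.
have [rn sp] := complete_reduction_eval rc ov tw.
have idI := ideal_gen_ideal (G_set X); have [_ _ Il Ir] := idI.
have gI s : TP s -> ideal_gen (G_set X) (gelt X s).
  by move=> Ts; apply: sub_ideal_gen; exists s.
have [Tt Tt' _ _] := ov.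
have Ired : ideal_gen (G_set X) (phi (red t t')).
  rewrite -[phi _](subKr (gelt X t * pth K (parr c) - pth K (parr a) * gelt X t')).
  apply: (ideal_sub BK idI).
    by apply: (ideal_sub BK idI); [apply: Ir; exact: gI|apply: Il; exact: gI].
  exact: (span_ideal BK idI gI sp).
suff r0 : phi (red t t') = 0.
  have := coef_eval ev BY BK (red t t') n.
  by rewrite r0 (pb_coef0 BK) => /esym.
apply/eqP/negPn/negP => /(lead_exists BK adm) [u lu].
have mu : multiple TP u by apply: tip_ideal_multiple Ired lu; rewrite -tI.
have /rn [/normal_multiple nu _] : pcoef (red t t') u != 0; last exact: nu mu.
have [] := lu; rewrite (coef_eval ev BY BK) => h _.
by apply: contraNneq h => ->; rewrite rmorph0.
Qed.

End Reductions.

(** * The monomial point *)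

Section Monomial.
Variables (K : fieldType) (Q : quiver) (gt : rel (qpath Q)).
Variables (adm : length_admissible gt) (T : {fset qpath Q}).
Hypothesis T2 : forall t, t \in T -> plen t = 2%N.
Local Notation TP := (T_paths T).
Local Notation BK := (pathalg_basis K Q).

Lemma G_set0 : G_set (0 : affpoint K gt T) = T_set K T.
Proof.
apply: eq_imagel => t _; apply: (rule0 BK) => i.
by rewrite ffunE.
Qed.

Lemma lead_pth t : lead (@pcoef K Q) gt (pth K t) t.
Proof.
split; first by rewrite (pb_coef_mono BK) eqxx oner_eq0.
move=> q; rewrite (pb_coef_mono BK).
by case: (eqVneq t q) => [-> _ /eqP|_ /eqP].
Qed.

Lemma mon_ideal_T : mon_ideal gt (ideal_gen (T_set K T)) = ideal_gen (T_set K T).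
Proof.
apply: (tip_ideal_eq (gt := gt)).
  by move=> x u Ix [xu _]; exact: (ideal_gen_monomial BK Ix xu).
move=> t Tt; exists (pth K t); last exact: lead_pth.
by apply: sub_ideal_gen; exists t.
Qed.

Lemma graded_T : graded_ideal (ideal_gen (T_set K T)).
Proof. by rewrite -G_set0; exact: graded_G_set. Qed.

Lemma groebner_T : groebner_basis gt (ideal_gen (T_set K T)) (T_set K T).
Proof.
by rewrite -G_set0; apply: groebner_G_set => //; rewrite G_set0; exact: mon_ideal_T.
Qed.

(** Each [t] in [T] is a multiple of a path of a monomial Groebner basis, hence
    equals it by comparing lengths. So [T] is in the ideal, and it generates
    the ideal because it has the same tips. *)
Lemma quadratic_monomial_uniq (I : set (pathalg K Q)) :
  quadratic_monomial_groebner gt I -> mon_ideal gt I = ideal_gen (T_set K T) ->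
  ideal_gen (T_set K T) = I.
Proof.
move=> [G [gI GI _ tG] Gp] tI.
have [H _ IE] := gI.
have idI : two_sided_ideal I by rewrite IE; exact: ideal_gen_ideal.
have TG t : TP t -> G (pth K t).
  move=> Tt; have [x Gx xt] : exists2 h, G h & lead (@pcoef K Q) gt h t.
    by apply: (tip_ideal_lead T2) Tt; rewrite tG.
  have [p _ px] := Gp x Gx; rewrite -px in Gx xt.
  by have -> : t = p by exact: lead_mono BK _ _ _ xt.
have TI : ideal_gen (T_set K T) `<=` I.
  by apply: ideal_gen_sub => // _ [t Tt <-]; apply: GI; exact: TG.
apply/esym; apply: (division_ideal BK adm (T := TP)) => //.
- exact: ideal_gen_ideal.
- by move=> x u; apply: tip_ideal_multiple; rewrite -tI.
move=> t Tt; exists (pth K t); last exact: lead_pth.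
by apply: sub_ideal_gen; exists t.
Qed.
End Monomial.
(** * The affine variety of strong Koszul algebras *)

Theorem proposition4p2 (K : fieldType) (Q : quiver) (gt : rel (qpath Q))
    (gt_adm : length_admissible gt)
    (T : {fset qpath Q}) (T2 : forall t, t \in T -> plen t = 2%N) :
  [/\
   (* (1) *)
   G_set (0 : affpoint K gt T) = T_set K T,
   (* (2) *)
   [/\ GrAlg (0 : affpoint K gt T),
       corresponds (ideal_gen (T_set K T)) (0 : affpoint K gt T)
     & strong_koszul gt (ideal_gen (T_set K T))],
   (* (3) *)
   forall I : set (pathalg K Q), graded_ideal I ->
     (strong_koszul gt I /\
      exists2 X : affpoint K gt T, GrAlg X & corresponds I X) <->
     mon_ideal gt I = ideal_gen (T_set K T),
   (* (4) *)
   forall red : qpath Q -> qpath Q -> pathalg (ypoly K gt T) Q,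
     reduction_choice red ->
     forall I : set (pathalg K Q), graded_ideal I ->
       (exists2 X : affpoint K gt T, zero_set (I_poly red) X & corresponds I X) <->
       mon_ideal gt I = ideal_gen (T_set K T)
   & (* (5) *)
   unique (fun I : set (pathalg K Q) =>
             quadratic_monomial_groebner gt I /\
             exists2 X : affpoint K gt T, GrAlg X & corresponds I X)
          (ideal_gen (T_set K T))].

Proof.
have S1 := G_set0 K gt T.
have kT := mon_ideal_koszul gt_adm T2 (graded_T K gt T2) (mon_ideal_T K gt T).
have GA0 : GrAlg (0 : affpoint K gt T) by rewrite /GrAlg /= S1; exact: kT.1.
have c0 : corresponds (ideal_gen (T_set K T)) (0 : affpoint K gt T).
  by rewrite /corresponds S1.
have koszulE I : (exists2 X : affpoint K gt T, GrAlg X & corresponds I X) ->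
    mon_ideal gt I = ideal_gen (T_set K T).
  by move=> [X GX ->]; exact: koszul_mon_ideal.
split=> //.
- by split=> //; exact: kT.1.
- move=> I gI; split=> [[_ /koszulE] //|tI].
  exact: mon_ideal_koszul.
- move=> red rc I gI; split=> [[X ZX ->]|tI].
    exact: zero_set_mon_ideal ZX.
  have [_ [X _ IX]] := mon_ideal_koszul gt_adm T2 gI tI.
  exists X => //; apply: mon_ideal_zero_set => //; by rewrite -IX.
split; first split.
- by exists (T_set K T); [exact: groebner_T|move=> _ [t Tt <-]; exists t => //; exact: T2].
- by exists 0.
by move=> I [qI /koszulE tI]; exact: quadratic_monomial_uniq tI.
Qed.
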